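(* For every $C>0$ there exist $\lambda_0$ large and $\varepsilon_0$ small such that the following holds. Let $n,m$ be integers with $n\to\infty$ and $|n-m|\le Cn^{2/3}$, and let $p=\frac{1+\varepsilon}{2(mn)^{1/2}}=\frac{1+\lambda(mn)^{-1/6}}{2(mn)^{1/2}}$ with $\lambda_0<|\lambda|$ and $|\varepsilon|<\varepsilon_0$. Then \[ \mathbb P[F_{n,m,p}\text{ is satisfiable}] = \begin{cases}\exp[-O(|\lambda|^{-3})] & \lambda<0,\\ \exp[-O(\lambda^3)] & \lambda>0.\end{cases} \]
   Context: $F_{n,m,p}$ is the random bipartite 2-SAT formula on variables $x_1,\dots,x_n$ and $y_1,\dots,y_m$ in which each of the $4nm$ bipartite clauses $\ell_1\vee\ell_2$ (with $\ell_1\in\{x_i,\bar x_i\}$, $\ell_2\in\{y_j,\bar y_j\}$) is included independently with probability $p$. $\lambda=\lambda(n)$ may depend on $n$; implicit constants in $O(\cdot)$ depend only on $C$. *)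

(* Defs.v *)
From mathcomp Require Import all_boot all_order all_algebra.
From mathcomp Require Import all_classical all_reals all_analysis.

Set Implicit Arguments.
Unset Strict Implicit.
Unset Printing Implicit Defensive.

Import Order.TTheory GRing.Theory Num.Theory.

Local Open Scope ring_scope.

(* A literal is a variable index with a sign; [true] is the positive literal. *)
Definition literal (n : nat) := ('I_n * bool)%type.

Definition bipartite_clause (n m : nat) := (literal n * literal m)%type.

Definition bipartite_formula (n m : nat) := {set bipartite_clause n m}.

Definition literal_holds n (a : {ffun 'I_n -> bool}) (l : literal n) : bool :=
  a l.1 == l.2.

Definition clause_holds n m (a : {ffun 'I_n -> bool}) (b : {ffun 'I_m -> bool})
    (c : bipartite_clause n m) : bool :=
  literal_holds a c.1 || literal_holds b c.2.

Definition satisfiable n m (F : bipartite_formula n m) : bool :=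
  [exists a : {ffun 'I_n -> bool}, exists b : {ffun 'I_m -> bool},
    [forall c in F, clause_holds a b c]].

Section RandomSubset.
Variables (R : realType) (T : finType) (p : R).

Definition random_subset_mass (F : {set T}) : R :=
  \prod_(c : T) (if c \in F then p else 1 - p).

(* A probability only when 0 <= p <= 1. *)
Definition random_subset_prob (E : pred {set T}) : R :=
  \sum_(F : {set T} | E F) random_subset_mass F.

End RandomSubset.

Definition prob_satisfiable (R : realType) (n m : nat) (p : R) : R :=
  random_subset_prob p (@satisfiable n m).

(* Main.v *)
(* Write N for the largest number of clauses of the form (neg x) \/ z that a
   literal x can occur in, so that 2 sqrt(mn) p = 1 + eps forces
   |N p - 1| = O(|eps|) when |n - m| = O(n^(2/3)) and |lambda| is large.

   Below the threshold, an unsatisfiable formula contains a bicycle: a path of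
   implications on distinct variables, closed up at both ends by implications
   into its own variables. The expected number of bicycles is at most
   sum_k 8 p k^2 (N p)^k <= 24 p / (1 - N p)^3 = O(|lambda|^-3).

   Above the threshold, put N p <= 1 + d with d of order eps and raise the
   probabilities of the clauses one at a time from (1 - d)/N to p. If F is
   satisfiable but F + c is not, both literals of c are on the spine
   {x : x implies neg x} of F. Satisfiability being decreasing and the spine
   increasing, Harris' inequality shows that each step costs a factor at least
   1 - O((p - (1 - d)/N) P_p(both literals of c on the spine)); it remains to
   bound E|spine|^2 by O(d^2 N^2), since then the total cost is exp(-O(d^3 N)).
   A spine literal has an out-path which either survives to depth 1/d or returns
   to itself within 1/d steps, an event of probability O(d). Given such a path W
   for x, a spine literal y either lies on W, or has, off W, an out-path which
   survives to depth 1/d, returns to itself or hits W; again by Harris, the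
   conditional probability of the latter is O(d). *)
Require Import Defs.
From mathcomp Require Import all_boot all_order all_algebra.
From mathcomp Require Import ring lra.

Set Implicit Arguments.
Unset Strict Implicit.
Unset Printing Implicit Defensive.

Import Order.TTheory GRing.Theory Num.Theory.

Local Open Scope ring_scope.

(** * Product measures on a finite power set *)

Section ProductMeasure.
Variables (R : realFieldType) (T : finType).
Implicit Types (w : T -> R) (c : T) (C F G : {set T}) (f g : {set T} -> R).
Implicit Types (A B E : pred {set T}).

Definition mass w F : R := \prod_c (if c \in F then w c else 1 - w c).

Definition expect w f : R := \sum_F mass w F * f F.

Definition prob w E : R := expect w (fun F => (E F)%:R).

Definition weight w := forall c, 0 <= w c <= 1.

Definition nondec f := forall F G, F \subset G -> f F <= f G.

Definition increasing E := forall F G, F \subset G -> E F -> E G.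

Definition decreasing E := forall F G, F \subset G -> E G -> E F.

Lemma mass_ge0 w F : weight w -> 0 <= mass w F.
Proof.
move=> hw; apply: prodr_ge0 => c _.
by case: (c \in F); have /andP[] := hw c => //; rewrite subr_ge0.
Qed.

Lemma expect_ext w f g : f =1 g -> expect w f = expect w g.
Proof. by move=> fg; apply: eq_bigr => F _; rewrite fg. Qed.

Lemma expect_le w f g :
  weight w -> (forall F, f F <= g F) -> expect w f <= expect w g.
Proof. by move=> hw fg; apply: ler_sum => F _; rewrite ler_wpM2l ?mass_ge0. Qed.

Lemma expect_cst w (a : R) : expect w (fun=> a) = a.
Proof.
rewrite /expect -mulr_suml /mass -[RHS]mul1r; congr (_ * _).
rewrite -(bigA_distr _ _ w (fun c => 1 - w c)).
by rewrite big1 // => c _ /=; rewrite addrC subrK.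
Qed.

Lemma expectD w f g : expect w (fun F => f F + g F) = expect w f + expect w g.
Proof. by rewrite -big_split; apply: eq_bigr => F _; rewrite mulrDr. Qed.

Lemma expectZ w (a : R) f : expect w (fun F => a * f F) = a * expect w f.
Proof. by rewrite mulr_sumr; apply: eq_bigr => F _; rewrite mulrCA. Qed.

Lemma expectB w f g : expect w (fun F => f F - g F) = expect w f - expect w g.
Proof.
by rewrite -[- expect w g]mulN1r -expectZ -expectD; apply: expect_ext => F; rewrite mulN1r.
Qed.

Lemma expect_sum w (I : Type) (s : seq I) (f : I -> {set T} -> R) :
  expect w (fun F => \sum_(i <- s) f i F) = \sum_(i <- s) expect w (f i).
Proof.
elim: s => [|i s IH].
  rewrite big_nil -[RHS](expect_cst w 0).
  by apply: expect_ext => F; rewrite big_nil.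
rewrite big_cons -IH -expectD.
by apply: expect_ext => F; rewrite big_cons.
Qed.

(** Integrates over the coordinates other than [c], on the sets avoiding [c]. The value [w c] does
    not enter, so two weights that differ only at [c] give the same result. *)
Definition expect_off w c f : R :=
  \sum_(F : {set T} | c \notin F) (\prod_(d | d != c) (if d \in F then w d else 1 - w d)) * f F.

Lemma expect_split w c f :
  expect w f =
  w c * expect_off w c (fun F => f (c |: F)) + (1 - w c) * expect_off w c f.
Proof.
rewrite /expect (bigID (fun F : {set T} => c \in F)) /=; congr (_ + _); last first.
  rewrite mulr_sumr; apply: eq_bigr => F /negbTE cF.
  by rewrite /mass (bigD1 c) //= cF mulrA.
rewrite (reindex_onto (fun F => c |: F) (fun F => F :\ c)) /=; last first.
  by move=> F cF; rewrite setD1K.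
rewrite mulr_sumr; apply: eq_big => [F|F].
  rewrite setU11 /=; apply/eqP/idP => [<-|cF]; first by rewrite !inE eqxx.
  by rewrite setU1K.
move=> _; rewrite /mass (bigD1 c) //= setU11 mulrA; congr (_ * _ * _).
by apply: eq_bigr => d dc; rewrite !inE (negbTE dc).
Qed.

Lemma expect_off_agree w w' c f :
  (forall d, d != c -> w d = w' d) -> expect_off w c f = expect_off w' c f.
Proof.
move=> ww; apply: eq_bigr => F _; congr (_ * _).
by apply: eq_bigr => d dc; rewrite ww.
Qed.

Lemma expect_off_setU1 w c f :
  expect_off w c (fun F => f (c |: F)) = expect w (fun F => f (c |: F)).
Proof.
rewrite [RHS](expect_split w c).
have -> : expect_off w c (fun F => f (c |: (c |: F))) =
          expect_off w c (fun F => f (c |: F)).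
  by apply: eq_bigr => F _; rewrite setUA setUid.
by rewrite -mulrDl addrC subrK mul1r.
Qed.

Lemma expect_off_setD1 w c f :
  expect_off w c f = expect w (fun F => f (F :\ c)).
Proof.
rewrite [RHS](expect_split w c).
have -> : expect_off w c (fun F => f ((c |: F) :\ c)) = expect_off w c f.
  by apply: eq_bigr => F cF; rewrite setU1K.
have -> : expect_off w c (fun F => f (F :\ c)) = expect_off w c f.
  apply: eq_bigr => F cF; congr (_ * f _).
  by apply/setP => d; rewrite !inE; case: eqP => // ->; rewrite (negbTE cF).
by rewrite -mulrDl addrC subrK mul1r.
Qed.

(** Both conditional expectations are written as full expectations under the same [w], so inductions
    over coordinates never change the probability space. *)
Lemma expect_cond w c f :
  expect w f = w c * expect w (fun F => f (c |: F)) +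
               (1 - w c) * expect w (fun F => f (F :\ c)).
Proof. by rewrite {1}(expect_split w c) expect_off_setU1 expect_off_setD1. Qed.

(** The list [s] holds the coordinates still to be revealed; inductions start from the enumeration
    of [T] and end at a constant function. *)
Definition depends_on (s : seq T) f := forall F, f F = f (F :&: [set c in s]).

Lemma depends_on_setU1 c s f : depends_on (c :: s) f -> depends_on s (fun F => f (c |: F)).
Proof.
move=> fs F; rewrite fs [RHS]fs; congr f; apply/setP => d; rewrite !inE.
by case: (d == c) => //=; case: (d \in F); case: (d \in s).
Qed.

Lemma depends_on_setD1 c s f : depends_on (c :: s) f -> depends_on s (fun F => f (F :\ c)).
Proof.
move=> fs F; rewrite fs [RHS]fs; congr f; apply/setP => d; rewrite !inE.
by case: (d == c) => //=; case: (d \in F); case: (d \in s).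
Qed.

Lemma depends_on_enum f : depends_on (enum T) f.
Proof. by move=> F; congr f; apply/setP => c; rewrite !inE mem_enum andbT. Qed.

Lemma depends_on_nil w f : depends_on [::] f -> expect w f = f set0.
Proof.
move=> f0; rewrite -[RHS](expect_cst w); apply: expect_ext => F.
by rewrite f0; congr f; apply/setP => c; rewrite !inE andbF.
Qed.

(** * Monotone functions: correlation and comparison of weights *)

Lemma nondec_setU1 c f : nondec f -> nondec (fun F => f (c |: F)).
Proof. by move=> fi F G FG; apply: fi; rewrite setUS. Qed.

Lemma nondec_setD1 c f : nondec f -> nondec (fun F => f (F :\ c)).
Proof. by move=> fi F G FG; apply: fi; rewrite setSD. Qed.

Lemma expect_cond_le w c f : weight w -> nondec f ->
  expect w (fun F => f (F :\ c)) <= expect w (fun F => f (c |: F)).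
Proof.
move=> hw fi; apply: expect_le => // F; apply: fi.
by apply: subset_trans (subD1set _ _) (subsetUr _ _).
Qed.

(** Induction on the revealed coordinates: conditioning on [c] splits the covariance into the
    average of the conditional covariances and the covariance of the conditional means, both
    nonnegative. *)
Lemma harris w f g : weight w -> nondec f -> nondec g ->
  expect w f * expect w g <= expect w (fun F => f F * g F).
Proof.
move=> hw; have := depends_on_enum g; have := depends_on_enum f.
elim: (enum T) f g => [|c s IH] f g fs gs fi gi.
  by rewrite !depends_on_nil // => F; rewrite fs gs.
rewrite (expect_cond w c f) (expect_cond w c g) (expect_cond w c (fun F => _ * _)).
have H1 := IH _ _ (depends_on_setU1 fs) (depends_on_setU1 gs)
  (nondec_setU1 c fi) (nondec_setU1 c gi).
have H0 := IH _ _ (depends_on_setD1 fs) (depends_on_setD1 gs)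
  (nondec_setD1 c fi) (nondec_setD1 c gi).
have Hf := expect_cond_le c hw fi; have Hg := expect_cond_le c hw gi.
have /andP[w0 w1] := hw c.
move: H1 H0 Hf Hg; set f1 := expect w (fun F => f (c |: F)).
set g1 := expect w (fun F => g (c |: F)); set f0 := expect w (fun F => f (F :\ c)).
set g0 := expect w (fun F => g (F :\ c)).
set e1 := expect w _; set e0 := expect w _ => H1 H0 Hf Hg.
(* The covariance of the two conditional means, which both increase when [c] is added. *)
have := mulr_ge0 (mulr_ge0 w0 (_ : 0 <= 1 - w c))
  (mulr_ge0 (_ : 0 <= f1 - f0) (_ : 0 <= g1 - g0)).
rewrite !subr_ge0 => /(_ w1 Hf Hg) Hm.
have K1 := ler_wpM2l w0 H1.
have K0 : (1 - w c) * (f0 * g0) <= (1 - w c) * e0 by rewrite ler_wpM2l // subr_ge0.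
lra.
Qed.

(** One coordinate at a time: raising the weight of [c] moves mass from [F :\ c] to [c |: F], where
    [f] is at least as large. *)
Lemma expect_weight_le w w' f : weight w -> weight w' ->
  (forall c, w c <= w' c) -> nondec f -> expect w f <= expect w' f.
Proof.
move=> hw hw' ww; have := depends_on_enum f.
elim: (enum T) f => [|c s IH] f fs fi; first by rewrite !depends_on_nil.
rewrite (expect_cond w c f) (expect_cond w' c f).
have H1 := IH _ (depends_on_setU1 fs) (nondec_setU1 c fi).
have H0 := IH _ (depends_on_setD1 fs) (nondec_setD1 c fi).
have Hd := expect_cond_le c hw' fi; have Hc := ww c.
have /andP[w0 w1] := hw c.
have K1 := ler_wpM2l w0 H1.
have : 0 <= 1 - w c by rewrite subr_ge0.
move=> /ler_wpM2l /(_ _ _ H0) K0.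
have : 0 <= w' c - w c by rewrite subr_ge0.
move=> /ler_wpM2l /(_ _ _ Hd); lra.
Qed.

(** Conditioning on [C \subset F] amounts to forcing [C] into [F]; the elements of [C] are peeled
    off one by one. *)
Lemma expect_subset w C f :
  expect w (fun F => (C \subset F)%:R * f F) =
  (\prod_(c in C) w c) * expect w (fun F => f (C :|: F)).
Proof.
elim: {C}#|C| {-2}C (erefl #|C|) f => [|k IH] C hC f.
  move/eqP: hC; rewrite cards_eq0 => /eqP ->; rewrite big_set0 mul1r.
  by apply: expect_ext => F; rewrite sub0set mul1r set0U.
have /card_gt0P[c cC] : (0 < #|C|)%N by rewrite hC.
rewrite (expect_cond w c) (big_setD1 c) //=.
have -> : expect w (fun F => (C \subset F :\ c)%:R * f (F :\ c)) = 0.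
  rewrite -[RHS](expect_cst w 0); apply: expect_ext => F.
  case: (boolP (C \subset _)) => [/subsetP /(_ _ cC)|_]; last by rewrite mul0r.
  by rewrite !inE eqxx.
rewrite mulr0 addr0 -mulrA; congr (_ * _).
have hk : #|C :\ c| = k by move: hC; rewrite (cardsD1 c) cC => -[].
have := IH (C :\ c) hk (fun F => f (c |: F)).
have -> : expect w (fun F => f (c |: (C :\ c :|: F))) = expect w (fun F => f (C :|: F)).
  by apply: expect_ext => F; rewrite setUA setD1K.
by move<-; apply: expect_ext => F; rewrite subDset.
Qed.

(** * Probabilities of events *)

Lemma prob_ext w A B : A =1 B -> prob w A = prob w B.
Proof. by move=> AB; apply: expect_ext => F; rewrite AB. Qed.

Lemma prob_weight_ext w w' A : w =1 w' -> prob w A = prob w' A.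
Proof.
move=> ww; apply: eq_bigr => F _; congr (_ * _).
by apply: eq_bigr => c _; rewrite ww.
Qed.

Lemma prob_le w A B : weight w -> (forall F, A F -> B F) -> prob w A <= prob w B.
Proof.
move=> hw AB; apply: expect_le => // F; rewrite ler_nat.
by case: (boolP (A F)) => // /AB ->.
Qed.

Lemma prob_ge0 w A : weight w -> 0 <= prob w A.
Proof. by move=> hw; rewrite -(expect_cst w 0); apply: expect_le. Qed.

Lemma prob_le1 w A : weight w -> prob w A <= 1.
Proof.
by move=> hw; rewrite -[leRHS](expect_cst w 1); apply: expect_le => // F; case: (A F).
Qed.

Lemma prob0 w : prob w xpred0 = 0.
Proof. by rewrite -[RHS](expect_cst w 0); apply: expect_ext. Qed.

Lemma prob_compl w A : prob w (fun F => ~~ A F) = 1 - prob w A.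
Proof.
rewrite -(expect_cst w 1) -expectB; apply: expect_ext => F.
by case: (A F); rewrite ?subr0 ?subrr.
Qed.

Lemma prob_ID w A B :
  prob w A = prob w (fun F => A F && B F) + prob w (fun F => A F && ~~ B F).
Proof.
rewrite -expectD; apply: expect_ext => F.
by case: (A F); case: (B F); rewrite ?addr0 ?add0r.
Qed.

Lemma prob_or w A B : weight w ->
  prob w (fun F => A F || B F) <= prob w A + prob w B.
Proof.
move=> hw; rewrite -expectD; apply: expect_le => // F.
by case: (A F); case: (B F); rewrite ?addr0 ?add0r // lerDl ler01.
Qed.

Lemma prob_has w (I : Type) (s : seq I) (E : I -> pred {set T}) : weight w ->
  prob w (fun F => has (E^~ F) s) <= \sum_(i <- s) prob w (E i).
Proof.
move=> hw; elim: s => [|i s IH] /=; first by rewrite big_nil prob0.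
by rewrite big_cons; apply: le_trans (prob_or _ _ hw) _; rewrite lerD2l.
Qed.

Lemma increasing_nondec A : increasing A -> nondec (fun F => (A F)%:R).
Proof.
move=> iA F G FG; rewrite ler_nat.
by case: (boolP (A F)) => // /(iA _ _ FG) ->.
Qed.

Lemma prob_weight_le w w' A : weight w -> weight w' ->
  (forall c, w c <= w' c) -> increasing A -> prob w A <= prob w' A.
Proof. by move=> hw hw' ww /increasing_nondec; apply: expect_weight_le. Qed.

Lemma decreasing_compl A : decreasing A -> increasing (fun F => ~~ A F).
Proof. by move=> dA F G FG; apply: contra; apply: dA. Qed.

Lemma prob_increasing_decreasing w A B : weight w -> increasing A -> decreasing B ->
  prob w (fun F => A F && B F) <= prob w A * prob w B.
Proof.
move=> hw iA dB.
have := harris hw (increasing_nondec iA) (increasing_nondec (decreasing_compl dB)).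
rewrite -/(prob _ _) -/(prob w (fun F => ~~ B F)) prob_compl.
have -> : expect w (fun F => (A F)%:R * (~~ B F)%:R) = prob w (fun F => A F && ~~ B F).
  by apply: expect_ext => F; rewrite -natrM mulnb.
have := prob_ID w A B; lra.
Qed.

Lemma prob_decreasing w A B : weight w -> decreasing A -> decreasing B ->
  prob w A * prob w B <= prob w (fun F => A F && B F).
Proof.
move=> hw dA dB.
have := prob_increasing_decreasing hw (decreasing_compl dA) dB.
rewrite prob_compl (prob_ext w (B := fun F => B F && ~~ A F)); last by move=> F; rewrite andbC.
have := prob_ID w B A.
rewrite (prob_ext w (A := fun F => B F && A F) (B := fun F => A F && B F)); last first.
  by move=> F; rewrite andbC.
lra.
Qed.

Lemma prob_all_decreasing w (I : Type) (s : seq I) (E : I -> pred {set T}) :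
  weight w -> (forall i, decreasing (E i)) ->
  \prod_(i <- s) prob w (E i) <= prob w (fun F => all (E^~ F) s).
Proof.
move=> hw dE; elim: s => [|i s IH] /=; first by rewrite big_nil [leRHS]expect_cst.
rewrite big_cons; apply: le_trans (ler_wpM2l (prob_ge0 _ hw) IH) _.
apply: prob_decreasing => // F G FG; apply: sub_all => j.
exact: dE.
Qed.

Lemma prob_subset w C : prob w (fun F => C \subset F) = \prod_(c in C) w c.
Proof.
have := expect_subset w C (fun=> 1); rewrite expect_cst mulr1 => <-.
by apply: expect_ext => F; rewrite mulr1.
Qed.

Lemma prob_subset_and w C A :
  prob w (fun F => (C \subset F) && A F) =
  (\prod_(c in C) w c) * prob w (fun F => A (C :|: F)).
Proof.
rewrite -(expect_subset w C (fun F => (A F)%:R)); apply: expect_ext => F.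
by rewrite -natrM mulnb.
Qed.

Lemma prob_mem_and w c A : (forall F, A (c |: F) = A F) ->
  prob w (fun F => (c \in F) && A F) = w c * prob w A.
Proof.
move=> Ac; have := prob_subset_and w [set c] A; rewrite big_set1.
rewrite (prob_ext w (A := fun F => A ([set c] :|: F)) Ac) => <-.
by apply: prob_ext => F; rewrite sub1set.
Qed.

(** After [C] is forced into [F], the event [A] is unchanged and [B] is still decreasing, so Harris
    applies to the conditioned measure. *)
Lemma prob_subset_and_le w C A B : weight w -> increasing A -> decreasing B ->
  (forall F, A (C :|: F) = A F) ->
  prob w (fun F => [&& C \subset F, A F & B F]) <=
  prob w A * prob w (fun F => (C \subset F) && B F).
Proof.
move=> hw iA dB AC; rewrite !prob_subset_and mulrCA.
apply: ler_wpM2l; first by apply: prodr_ge0 => c _; have /andP[] := hw c.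
rewrite (prob_ext w (B := fun F => A F && B (C :|: F))); last by move=> F; rewrite AC.
apply: prob_increasing_decreasing => // F G FG; apply: dB.
by rewrite setUS.
Qed.

(** Testing [E] only at the first witness that occurs splits the event into disjoint pieces, so that
    bounding it costs no sum over witnesses. *)
Fixpoint first_witness (I : Type) (C : I -> {set T}) (E : I -> pred {set T})
    (s : seq I) F : bool :=
  if s is i :: s' then if C i \subset F then E i F else first_witness C E s' F
  else false.

(* "None of the earlier witnesses occurs" is a decreasing event, hence
   negatively correlated with the increasing event [E i]: this is a substitute
   for the van den Berg-Kesten inequality. *)
Lemma prob_first_witness w (I : eqType) (C : I -> {set T}) (E : I -> pred {set T})
    (s : seq I) (b : R) :
  weight w -> (forall i, i \in s -> increasing (E i)) ->
  (forall i, i \in s -> forall F, E i (C i :|: F) = E i F) ->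
  (forall i, i \in s -> prob w (E i) <= b) ->
  prob w (first_witness C E s) <= b * prob w (fun F => has (fun i => C i \subset F) s).
Proof.
move=> hw iE EC Eb.
(* The decreasing event [B] records that the witnesses already passed are absent. *)
suff H B : decreasing B -> prob w (fun F => B F && first_witness C E s F) <=
    b * prob w (fun F => B F && has (fun i => C i \subset F) s).
  exact: (H xpredT).
elim: s iE EC Eb B => [|i s IH] iE EC Eb B dB /=.
  have z P : P =1 xpred0 -> prob w P = 0 by move/(prob_ext w)->; apply: prob0.
  by rewrite !z ?mulr0 // => F; rewrite andbF.
rewrite (prob_ID w _ (fun F => C i \subset F)).
rewrite [X in _ <= _ * X](prob_ID w _ (fun F => C i \subset F)) mulrDr.
apply: lerD.
  have -> : prob w (fun F => B F && (if C i \subset F then E i F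
      else first_witness C E s F) && (C i \subset F)) =
      prob w (fun F => [&& C i \subset F, E i F & B F]).
    by apply: prob_ext => F; case: (C i \subset F); rewrite ?andbF // andbT andbC.
  have -> : prob w (fun F => B F && ((C i \subset F) ||
      has (fun j => C j \subset F) s) && (C i \subset F)) =
      prob w (fun F => (C i \subset F) && B F).
    by apply: prob_ext => F; case: (C i \subset F); rewrite ?andbF // !andbT.
  apply: le_trans (prob_subset_and_le hw _ dB _) _.
  - by apply: iE; rewrite mem_head.
  - by apply: EC; rewrite mem_head.
  apply: ler_wpM2r; first exact: prob_ge0.
  by apply: Eb; rewrite mem_head.
have -> : prob w (fun F => B F && (if C i \subset F then E i F
    else first_witness C E s F) && ~~ (C i \subset F)) =
    prob w (fun F => (B F && ~~ (C i \subset F)) && first_witness C E s F).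
  by apply: prob_ext => F; case: (C i \subset F); rewrite ?andbF ?andbT.
have -> : prob w (fun F => B F && ((C i \subset F) ||
    has (fun j => C j \subset F) s) && ~~ (C i \subset F)) =
    prob w (fun F => (B F && ~~ (C i \subset F)) && has (fun j => C j \subset F) s).
  by apply: prob_ext => F; case: (C i \subset F); rewrite ?andbF ?andbT.
apply: IH; [move=> j js|move=> j js|move=> j js|].
- by apply: iE; rewrite inE js orbT.
- by apply: EC; rewrite inE js orbT.
- by apply: Eb; rewrite inE js orbT.
move=> F G FG /andP[BG CG]; rewrite (dB _ _ FG BG); apply: contra CG.
by move/subset_trans; apply.
Qed.

End ProductMeasure.

(** * The implication digraph of a bipartite formula *)

Lemma sumn_map_le (T : eqType) (f : T -> nat) (s : seq T) (b : nat) :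
  {in s, forall x, f x <= b}%N -> (sumn [seq f x | x <- s] <= size s * b)%N.
Proof.
elim: s => //= x s IH fb; rewrite mulSn leq_add ?fb ?mem_head // IH // => y ys.
by rewrite fb // inE ys orbT.
Qed.

Section ImplicationDigraph.
Variables n m : nat.

Notation var := ('I_n + 'I_m)%type.
Notation lit := (var * bool)%type.
Notation clause := (bipartite_clause n m).
Notation formula := (bipartite_formula n m).
Implicit Types (F G : formula) (c : clause) (u v x y z : lit) (s t p : seq lit).
Implicit Types (U : seq var).

Definition neg u : lit := (u.1, ~~ u.2).

(* The clause equivalent to the implication [u -> v], if it is bipartite. *)
Definition arc u v : option clause :=
  match u.1, v.1 with
  | inl i, inr j => Some ((i, ~~ u.2), (j, v.2))
  | inr j, inl i => Some ((i, v.2), (j, ~~ u.2))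
  | _, _ => None
  end.

Definition implies F u v : bool := if arc u v is Some c then c \in F else false.

Definition first_lit c : lit := (inl c.1.1, c.1.2).
Definition second_lit c : lit := (inr c.2.1, c.2.2).

Lemma negK : involutive neg.
Proof. by case=> v b; rewrite /neg /= negbK. Qed.

Lemma neg_neq u : neg u != u.
Proof. by case: u => v []; rewrite xpair_eqE andbF. Qed.

Lemma arc_neg u v : arc (neg v) (neg u) = arc u v.
Proof. by case: u v => [[i|i] a] [[j|j] b] //=; rewrite /arc /= negbK. Qed.

(** A clause encodes one implication and its contrapositive. The premise that [arc u v] is defined
    excludes an equality of two undefined arcs. *)
Lemma arc_inj u v x y : arc u v -> arc u v = arc x y ->
  u = x /\ v = y \/ u = neg y /\ v = neg x.
Proof.
case: u v x y => [[i|i] a] [[j|j] b] [[i'|i'] a'] [[j'|j'] b'] //= _ [];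
  move=> -> e1 -> e2; move: e1 e2; rewrite /neg /=;
  by case: a a' b b' => [] [] [] []; auto.
Qed.

Lemma arc_clause c : arc (neg (first_lit c)) (second_lit c) = Some c.
Proof. by case: c => [[i a] [j b]]; rewrite /arc /= negbK. Qed.

Lemma implies_neg F u v : implies F (neg v) (neg u) = implies F u v.
Proof. by rewrite /implies arc_neg. Qed.

Lemma implies_arc F u v : implies F u v -> arc u v.
Proof. by rewrite /implies; case: (arc u v). Qed.

Lemma implies_sub F G u v : F \subset G -> implies F u v -> implies G u v.
Proof. by rewrite /implies => /subsetP FG; case: (arc u v) => // c /FG. Qed.

Lemma connect_implies_sub F G u v : F \subset G ->
  connect (implies F) u v -> connect (implies G) u v.
Proof.
move=> FG; apply: connect_sub => {}u {}v h; apply: connect1.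
exact: implies_sub FG h.
Qed.

Lemma connect_implies_neg F u v :
  connect (implies F) u v -> connect (implies F) (neg v) (neg u).
Proof.
move=> /connectP[p]; elim: p u => [|z p IH] u /=; first by move=> _ ->.
move=> /andP[uz zp] vE; apply: connect_trans (IH z zp vE) _.
by apply: connect1; rewrite implies_neg.
Qed.

Definition holds (a : var -> bool) u : bool := a u.1 == u.2.

Lemma holds_neg a u : holds a (neg u) = ~~ holds a u.
Proof. by rewrite /holds /=; case: (a u.1) (u.2) => [] []. Qed.

Lemma satisfiableP F :
  reflect (exists a, forall u v, implies F u v -> holds a u -> holds a v)
          (satisfiable F).
Proof.
apply: (iffP existsP) => [[a /existsP[b /forallP ab]]|[a aP]].
  exists (fun w => match w with inl i => a i | inr j => b j end).
  move=> [[i|i] s] [[j|j] t] //; rewrite /implies /= => cF;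
    move: (implyP (ab _) cF) => {cF}; rewrite /clause_holds /literal_holds /holds /=.
    by case: (a i) s => [] [].
  by case: (b i) s => [] []; rewrite ?orbT ?orbF.
exists [ffun i => a (inl i)]; apply/existsP; exists [ffun j => a (inr j)].
apply/forallP => c; apply/implyP => cF.
have := aP (neg (first_lit c)) (second_lit c).
rewrite /implies arc_clause cF holds_neg => /(_ isT).
rewrite /clause_holds /literal_holds /holds /= !ffunE.
by case: (a (inl c.1.1) == _) => //= ->.
Qed.

Lemma satisfiable_decreasing : decreasing (@satisfiable n m).
Proof.
move=> F G FG /satisfiableP[a aP]; apply/satisfiableP; exists a => u v h.
by apply: aP; apply: implies_sub h.
Qed.

(* [neg u] is forced by the formula. *)
Definition spine u F : bool := connect (implies F) u (neg u).

Lemma spine_increasing u : increasing (spine u).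
Proof. by move=> F G; apply: connect_implies_sub. Qed.

(* Outside the spine, set everything reachable from [u] to true. *)
Lemma satisfiable_extend F u : satisfiable F -> ~~ spine u F ->
  exists2 a, holds a u & forall v z, implies F v z -> holds a v -> holds a z.
Proof.
move=> /satisfiableP[a aP] nu.
have excl z : connect (implies F) u z -> ~~ connect (implies F) u (neg z).
  move=> uz; apply: contra nu => /connect_implies_neg; rewrite negK.
  exact: connect_trans.
(* Literals reachable from [u] become true and their negations false, which is consistent by [excl];
   all other variables keep their value under [a]. *)
pose a' w := connect (implies F) u (w, true) ||
  ~~ connect (implies F) u (w, false) && a w.
have a'E z : holds a' z =
    connect (implies F) u z || ~~ connect (implies F) u (neg z) && holds a z.
  case: z => v []; rewrite /holds /a' /neg /=; first by rewrite !eqb_id.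
  have := excl (v, true); have := excl (v, false); rewrite /neg /=.
  case: (connect _ _ (v, true)) => /=; case: (connect _ _ (v, false)) => //=.
  by move/(_ isT).
exists a'; first by rewrite a'E connect0.
move=> v z vz; rewrite !a'E => /orP[uv|/andP[nv av]].
  by rewrite (connect_trans uv (connect1 vz)).
rewrite (aP _ _ vz av) andbT; apply/orP; right.
apply: contra nv => uz; apply: connect_trans uz (connect1 _).
by rewrite implies_neg.
Qed.

Lemma satisfiable_setU1 F c :
  satisfiable (F :\ c) -> ~~ spine (first_lit c) (F :\ c) || ~~ spine (second_lit c) (F :\ c) ->
  satisfiable (c |: F).
Proof.
move=> satF nspine.
suff [a ac aP] : exists2 a, holds a (first_lit c) || holds a (second_lit c) &
    forall u v, implies (F :\ c) u v -> holds a u -> holds a v.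
  apply/satisfiableP; exists a => u v uv.
  case: (boolP (implies (F :\ c) u v)) => [/aP //|nuv].
  have : arc (neg (first_lit c)) (second_lit c) = arc u v.
    rewrite arc_clause; move: uv nuv; rewrite /implies.
    by case: (arc u v) => // d; rewrite !inE; case: eqP => [-> //|_ /= ->].
  move=> /arc_inj []; rewrite ?arc_clause //.
    by case=> <- <-; rewrite holds_neg; case: (holds a (first_lit c)) ac.
  case=> uE vE; move: ac; rewrite -(negK (first_lit c)) uE vE.
  by rewrite !holds_neg negbK; case: (holds a v) => //= /negbTE ->.
by case/orP: nspine => /(satisfiable_extend satF)[a au aP]; exists a; rewrite // au ?orbT.
Qed.

(** Remove clauses until the formula becomes satisfiable. The clause removed last, with literals [a]
    and [b], has both on the spine, so [a] implies [neg a], which implies [b], then [neg b], then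
    [a]. *)
Lemma unsatisfiable_contradiction F : ~~ satisfiable F ->
  exists2 u, connect (implies F) u (neg u) & connect (implies F) (neg u) u.
Proof.
elim: {F}#|F| {-2}F (erefl #|F|) => [|k IH] F hF nF.
  case/negP: nF; apply/satisfiableP; exists (fun=> true) => u v.
  move/eqP: hF; rewrite cards_eq0 => /eqP ->.
  by rewrite /implies; case: (arc u v) => // c; rewrite inE.
have /card_gt0P[c cF] : (0 < #|F|)%N by rewrite hF.
have hk : #|F :\ c| = k by move: hF; rewrite (cardsD1 c) cF => -[].
have sub := subD1set F c.
case: (boolP (satisfiable (F :\ c))) => [satc|/(IH _ hk)[u h1 h2]]; last first.
  by exists u; apply: connect_implies_sub sub _.
have : spine (first_lit c) (F :\ c) && spine (second_lit c) (F :\ c).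
  apply: contraR nF; rewrite negb_and => /(satisfiable_setU1 satc).
  by rewrite (setUidPr _) // sub1set.
case/andP=> /(connect_implies_sub sub) s1 /(connect_implies_sub sub) s2.
exists (first_lit c) => //.
have h : implies F (neg (first_lit c)) (second_lit c) by rewrite /implies arc_clause.
apply: connect_trans (connect1 h) (connect_trans s2 (connect1 _)).
by rewrite -[first_lit c]negK implies_neg.
Qed.

(** * Walks and the clauses they use *)

Notation vars := (map (@fst var bool)).

Lemma eq_lit_of_uniq s u v : uniq (vars s) -> u \in s -> v \in s -> u.1 = v.1 -> u = v.
Proof.
elim: s => // z s IH /= /andP[zs us]; rewrite !inE.
move=> /orP[/eqP->|su] /orP[/eqP->|sv] // e; last exact: IH.
- by case/negP: zs; rewrite e map_f.
- by case/negP: zs; rewrite -e map_f.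
Qed.

Definition good U s : bool := uniq (vars s) && all (fun v => v.1 \notin U) s.

Lemma first_bad U s : ~~ good U s -> exists t z r,
  [/\ s = t ++ z :: r, good U t & z.1 \in U ++ vars t].
Proof.
elim/last_ind: s => [|s z IH] //.
case: (boolP (good U s)) => [gs|/IH[t [y [r [-> gt hy]]]] _]; last first.
  by exists t, y, (rcons r z); rewrite rcons_cat.
rewrite /good map_rcons rcons_uniq all_rcons => h; exists s, z, [::].
rewrite cats1; split=> //; rewrite mem_cat; case/andP: gs => gs1 gs2.
by move: h; rewrite gs1 gs2 !andbT negb_and !negbK orbC.
Qed.

Definition bip u v : bool := arc u v.

Lemma path_implies_bip F u s : path (implies F) u s -> path bip u s.
Proof. by apply: sub_path => x y; apply: implies_arc. Qed.

Definition clauses u s : {set clause} := [set c in pmap id (pairmap arc u s)].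

Lemma path_implies F u s : path bip u s -> path (implies F) u s = (clauses u s \subset F).
Proof.
elim: s u => [|v s IH] u /=; first by move=> _; apply/esym/subsetP => c; rewrite inE.
move=> /andP[]; rewrite /bip; case E: (arc u v) => [c|] // _ /IH ->.
have -> : clauses u (v :: s) = c |: clauses v s.
  by apply/setP => d; rewrite !inE /= E /= inE.
by rewrite subUset sub1set /implies E.
Qed.

Lemma all_pairmap_arc u s : all isSome (pairmap arc u s) = path bip u s.
Proof. by elim: s u => //= v s IH u; rewrite IH. Qed.

Lemma card_clauses u s : path bip u s -> uniq (pairmap arc u s) ->
  #|clauses u s| = size s.
Proof.
move=> us uq; rewrite cardsE; have /card_uniqP -> : uniq (pmap id (pairmap arc u s)).
  by apply: (@pmap_uniq _ _ id Some) => // -[].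
rewrite size_pmap -(size_pairmap arc u s).
by apply/eqP; rewrite -all_count all_pairmap_arc.
Qed.

Lemma arc_pairmapP u s (o : option clause) : o \in pairmap arc u s ->
  exists x y, [/\ o = arc x y, x \in belast u s & y \in s].
Proof.
elim: s u => // v s IH u /=; rewrite inE => /orP[/eqP->|/IH[x [y [-> xs ys]]]].
  by exists u, v; rewrite !mem_head.
by exists x, y; rewrite !inE xs ys !orbT.
Qed.

Lemma mem_clausesP u s c : c \in clauses u s ->
  exists x y, [/\ Some c = arc x y, x \in belast u s & y \in s].
Proof. by rewrite inE mem_pmap map_id => /arc_pairmapP. Qed.

(** A clause used twice would give the same arc or its contrapositive, and either contradicts
    distinctness of the variables before [z]. The endpoint [z] may repeat a variable, as in closing
    steps. *)
Lemma uniq_pairmap_arc u s z : path bip u (rcons s z) -> uniq (vars (u :: s)) ->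
  uniq (pairmap arc u (rcons s z)).
Proof.
rewrite rcons_path -cats1 pairmap_cat => /andP[us sz] uq /=.
rewrite cats1 rcons_uniq; apply/andP; split.
  apply/negP => /arc_pairmapP[x [y [/(arc_inj sz) H xs ys]]].
  case: H => [[lx _]|[ly _]].
    have : uniq (u :: s) := map_uniq uq.
    by rewrite lastI rcons_uniq lx xs.
  have e : last u s = y.
    by apply: (eq_lit_of_uniq uq); rewrite ?mem_last ?inE ?ys ?orbT // ly.
  by have := neg_neq y; rewrite -ly e eqxx.
elim: s u us uq {sz} => //= v s IH u /andP[uv vs] /andP[uns uq].
rewrite IH // andbT; apply/negP => /arc_pairmapP[x [y [/(arc_inj uv) H xs ys]]].
have mem w : w \in v :: s -> u.1 != w.1.
  by move=> ws; apply: contraNneq uns => ->; apply: (map_f fst ws).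
case: H => [[e _]|[e _]].
  by have := mem _ (mem_belast xs); rewrite e eqxx.
by have := mem y; rewrite inE ys orbT e eqxx => /(_ isT).
Qed.

Definition closers U : seq lit := [seq (w, true) | w <- U] ++ [seq (w, false) | w <- U].

Lemma size_closers U : size (closers U) = (2 * size U)%N.
Proof. by rewrite size_cat !size_map mul2n addnn. Qed.

Lemma mem_closers U u : (u \in closers U) = (u.1 \in U).
Proof.
rewrite mem_cat; apply/idP/idP => [/orP[]/mapP[v vU ->] //|].
by case: u => v [] /= vU; apply/orP; [left|right]; apply/mapP; exists v.
Qed.

Definition nbrs u : seq lit :=
  match u.1 with
  | inl _ => closers [seq inr j | j <- enum 'I_m]
  | inr _ => closers [seq inl i | i <- enum 'I_n]
  end.

Lemma mem_nbrs u v : (v \in nbrs u) = bip u v.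
Proof.
have inl_inr i : (inl i : var) \in [seq inr j | j <- enum 'I_m] = false.
  by apply/mapP => -[].
have inr_inl j : (inr j : var) \in [seq inl i | i <- enum 'I_n] = false.
  by apply/mapP => -[].
case: u v => [[i|i] a] [[j|j] b]; rewrite /nbrs mem_closers /bip /= ?inl_inr ?inr_inl //;
  by rewrite map_f // mem_enum.
Qed.

(** The [N] of the overview: taking the larger side bounds the out-degree of literals on both sides
    at once. *)
Definition degree : nat := (2 * maxn n m)%N.

Lemma size_nbrs u : (size (nbrs u) <= degree)%N.
Proof.
rewrite /nbrs /degree; case: u.1 => _; rewrite size_closers size_map size_enum_ord leq_mul2l.
  by rewrite leq_maxr.
by rewrite leq_maxl.
Qed.

Fixpoint walks k u : seq (seq lit) :=
  if k is k'.+1 then [seq v :: s | v <- nbrs u, s <- walks k' v] else [:: [::]].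

Lemma mem_walks k u s : (s \in walks k u) = (size s == k) && path bip u s.
Proof.
elim: k u s => [|k IH] u [|v s] /=; rewrite ?inE //.
  by apply/negbTE/allpairsPdep => -[? [? []]].
rewrite eqSS; apply/allpairsPdep/idP => [[x [t [xu tx [-> ->]]]]|].
  by move: xu tx; rewrite mem_nbrs IH => -> /andP[-> ->].
by case/and3P=> sk uv vs; exists v, s; rewrite mem_nbrs uv IH sk vs.
Qed.

Lemma size_walks k u : (size (walks k u) <= degree ^ k)%N.
Proof.
elim: k u => [|k IH] u //=; rewrite size_allpairs_dep expnS.
apply: leq_trans (sumn_map_le (b := (degree ^ k)%N) _) _; first by move=> v _.
by rewrite leq_mul2r size_nbrs orbT.
Qed.

(** * Witnesses of escape *)

Definition long_witnesses k U x := [seq s <- walks k x | good U (x :: s)].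

(** The closing vertex [z] comes after [j] self-avoiding steps, so these walks have [j.+1] steps. *)
Definition hit_witnesses j U x : seq (seq lit) :=
  [seq rcons s z | s <- long_witnesses j U x,
    z <- [seq z <- closers (U ++ vars (x :: s)) | bip (last x s) z]].

Definition witnesses k U x : seq (seq lit) :=
  long_witnesses k U x ++ flatten [seq hit_witnesses j U x | j <- iota 0 k].

(* Some walk from [x] outside [U] has length [k] or, in at most [k] steps,
   comes back to one of its own variables or enters [U]. *)
Definition escape k U x F : bool := has (fun s => clauses x s \subset F) (witnesses k U x).

Lemma hit_witnessesP j U x t : t \in hit_witnesses j U x ->
  exists s z, [/\ t = rcons s z, size s = j, good U (x :: s),
    z.1 \in U ++ vars (x :: s) & path bip x (rcons s z)].
Proof.
case/allpairsPdep=> s [z []]; rewrite !mem_filter mem_walks mem_closers.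
case/andP=> gs /andP[/eqP sj xs] /andP[sz zs] ->.
by exists s, z; rewrite rcons_path xs.
Qed.

Lemma mem_witnesses k U x t : t \in witnesses k U x ->
  (exists2 j, (j < k)%N & t \in hit_witnesses j U x) \/
  [/\ size t = k, good U (x :: t) & path bip x t].
Proof.
rewrite mem_cat => /orP[|/flattenP[l /mapP[j]]].
  by rewrite mem_filter mem_walks => /andP[gt /andP[/eqP ? ?]]; right.
by rewrite mem_iota => jk -> tj; left; exists j.
Qed.

Lemma witnesses_bip k U x t : t \in witnesses k U x -> path bip x t.
Proof. by case/mem_witnesses => [[j _ /hit_witnessesP[s [z [-> ]]]]|[]]. Qed.

Lemma witnesses_uniq k U x t : t \in witnesses k U x -> uniq (pairmap arc x t).
Proof.
case/mem_witnesses => [[j _ /hit_witnessesP[s [z [-> _ /andP[gs _] _ xs]]]]|].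
  exact: uniq_pairmap_arc.
case/lastP: t => // t z [_ /andP[+ _] xt]; rewrite -rcons_cons map_rcons rcons_uniq.
by case/andP=> _; apply: uniq_pairmap_arc.
Qed.

Lemma witnesses_size k U x t : t \in witnesses k U x -> (size t <= k)%N.
Proof.
case/mem_witnesses => [[j jk /hit_witnessesP[s [z [-> sj _ _ _]]]]|[-> //]].
by rewrite size_rcons sj.
Qed.

Lemma witnesses_sources k U x t : t \in witnesses k U x ->
  {in belast x t, forall u, u.1 \notin U}.
Proof.
move=> + u ut; case/mem_witnesses => [[j _ /hit_witnessesP[s [z]]]|].
  case=> tE _ /andP[_ /allP gs] _ _; apply: gs.
  by move: ut; rewrite tE belast_rcons.
by case=> _ /andP[_ /allP gs] _; apply: gs; apply: mem_belast.
Qed.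

Lemma card_witness k U x t : t \in witnesses k U x -> #|clauses x t| = size t.
Proof. by move=> h; rewrite card_clauses ?(witnesses_bip h) ?(witnesses_uniq h). Qed.

(** Cut the walk at its first bad vertex. If fewer than [k] good steps precede it, the cut walk is a
    hitting witness; otherwise its first [k] steps form a long witness. *)
Lemma walk_escape k U x F t : x.1 \notin U -> path (implies F) x t ->
  ~~ good U (x :: t) -> escape k U x F.
Proof.
move=> xU xt /first_bad[[|y s] [z [r [/= e gs zs]]]].
  by case: e zs => <- _; rewrite cats0 (negbTE xU).
case: e gs zs xt => <- -> gs zs; rewrite -cat_rcons cat_path => /andP[xs _].
case: (ltnP (size s) k) => sk.
  apply/hasP; exists (rcons s z); last by rewrite -path_implies ?(path_implies_bip xs).
  rewrite mem_cat; apply/orP; right; apply/flattenP.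
  exists (hit_witnesses (size s) U x); first by apply: map_f; rewrite mem_iota.
  have := path_implies_bip xs; rewrite rcons_path => /andP[xs' sz].
  by apply: allpairs_f_dep; rewrite !mem_filter ?gs ?sz ?mem_closers //= mem_walks eqxx.
have kE : take k (rcons s z) = take k s by rewrite -cats1 takel_cat.
have := take_path k xs; rewrite kE => xk.
apply/hasP; exists (take k s); last by rewrite -path_implies ?(path_implies_bip xk).
rewrite mem_cat mem_filter mem_walks size_takel // eqxx (path_implies_bip xk) andbT.
apply/orP; left; case/andP: gs => g1 g2.
have -> : x :: take k s = take k.+1 (x :: s) by [].
rewrite /good map_take take_uniq // andTb ?andbT.
by apply/allP => u /mem_take; apply: (allP g2).
Qed.

(** A path from [x] to [neg x] returns to its own first variable, so it is not good. *)
Lemma spine_escape k U x F : x.1 \notin U -> spine x F -> escape k U x F.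
Proof.
move=> xU /connectP[t xt lt]; apply: walk_escape xU xt _.
case/lastP: t lt => [|t z]; first by move=> /= /eqP; rewrite (negbTE (neg_neq x)).
rewrite last_rcons => <-; rewrite /good -rcons_cons map_rcons rcons_uniq.
by rewrite inE eqxx.
Qed.

Lemma escape_increasing k U x : increasing (escape k U x).
Proof.
move=> F G FG; apply: sub_has => t; move/subset_trans; exact.
Qed.

(** All arcs of a witness start off [U]. A clause shared with a walk inside [U] would, as an arc or
    as a contrapositive, give such a start a variable of [U]. *)
Lemma escape_indep k U x y s F : {subset vars (y :: s) <= U} ->
  escape k U x (clauses y s :|: F) = escape k U x F.
Proof.
move=> sU; apply: eq_in_has => t tw.
apply/subsetP/subsetP => H c ct; last by rewrite inE H ?orbT.
have := H c ct; rewrite inE => /orP[] // cs; exfalso.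
have [a [b [ce at_ _]]] := mem_clausesP ct.
have [a' [b' [ce' as_ bs]]] := mem_clausesP cs.
have aU := witnesses_sources tw at_.
have memU w : w \in y :: s -> w.1 \in U by move=> ws; apply: sU; apply: map_f.
have ab : arc a b by rewrite -ce.
case: (arc_inj ab (etrans (esym ce) ce')) => -[ae _]; case/negP: aU; rewrite ae.
  exact: memU (mem_belast as_).
by apply: (memU b'); rewrite inE bs orbT.
Qed.

(** The entry [(s, (y, z))] encodes the walk [y], [w], [s], [z], whose ends lie on variables of
    [w :: s]. The two end arcs must be different clauses, so that the [k.+2] clauses are
    distinct. *)
Definition bicycles_at k w : seq (seq lit * (lit * lit)) :=
  [seq (s, yz) | s <- [seq s <- walks k w | uniq (vars (w :: s))],
    yz <- [seq yz <- allpairs pair (closers (vars (w :: s))) (closers (vars (w :: s))) |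
      [&& bip yz.1 w, bip (last w s) yz.2 & arc yz.1 w != arc (last w s) yz.2]]].

Definition bicycle_clauses w (b : seq lit * (lit * lit)) : {set clause} :=
  clauses b.2.1 (w :: rcons b.1 b.2.2).

Lemma size_bicycles_at k w : (size (bicycles_at k w) <= degree ^ k * (2 * k.+1) ^ 2)%N.
Proof.
rewrite size_allpairs_dep.
apply: leq_trans (sumn_map_le (b := ((2 * k.+1) ^ 2)%N) _) _ => [s|].
  rewrite mem_filter mem_walks => /and3P[_ /eqP sk _].
  rewrite size_filter; apply: leq_trans (count_size _ _) _.
  by rewrite size_allpairs size_closers /= size_map sk mulnn.
rewrite leq_mul2r size_filter (leq_trans (count_size _ _)) ?orbT //.
exact: size_walks.
Qed.

Lemma card_bicycle k w b : b \in bicycles_at k w -> #|bicycle_clauses w b| = k.+2.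
Proof.
case/allpairsPdep=> s [[y z] []]; rewrite !mem_filter mem_walks /=.
case/andP=> /andP[ws uq] /andP[/eqP sk pw] /andP[/and3P[yw sz ne] _] ->.
have pb : path bip w (rcons s z) by rewrite rcons_path pw.
rewrite /bicycle_clauses /= card_clauses /= ?yw //; first by rewrite size_rcons sk.
rewrite uniq_pairmap_arc //= ?ws ?uq // andbT -cats1 pairmap_cat /= cats1 mem_rcons inE.
rewrite (negbTE ne) /=; apply/negP => /arc_pairmapP[a [c [/(arc_inj yw) H a_s cs]]].
case: H => -[_ e].
  by move: ws; rewrite e map_f.
have := mem_belast a_s; rewrite inE => /orP[/eqP ae|as_].
  by have := neg_neq w; rewrite -{1}ae -e eqxx.
by move: ws; rewrite e (map_f fst as_).
Qed.

Lemma path_implies_rev_neg F x t z : path (implies F) x (rcons t z) ->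
  path (implies F) (neg z) (rcons (rev (map neg t)) (neg x)).
Proof.
elim: t x => [|y t IH] x /=; first by rewrite implies_neg.
move=> /andP[xy /IH h]; rewrite rev_cons rcons_path h last_rcons.
by rewrite implies_neg.
Qed.

(** From a contradictory [u], follow the path to [neg u] until a variable repeats, at [z], and the
    path from [neg u] back until it repeats a variable or meets the first piece, at [y]. The
    contrapositive of the second piece runs from [neg y] to [u]; glued before the first piece it
    gives the bicycle. *)
Lemma unsatisfiable_bicycle F : ~~ satisfiable F ->
  exists k w, (k < n + m)%N /\ has (fun b => bicycle_clauses w b \subset F) (bicycles_at k w).
Proof.
move/unsatisfiable_contradiction => [u /connectP[p0 p0P p0l] /connectP[q qP ql]].
(* A path without repeated literals guarantees [z != u] below. *)
case/shortenP: p0P p0l => p up uqp _ pl {p0}.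
have : ~~ good [::] (u :: p).
  case/lastP: p pl {up uqp} => [|p z].
    by move=> /= /eqP; rewrite (negbTE (neg_neq u)).
  by rewrite last_rcons => <-; rewrite /good -rcons_cons map_rcons rcons_uniq inE eqxx.
case/first_bad=> [[|u' s]] [z [r [/= e gs zs]]] //.
case: e gs zs => <- pE; rewrite /good => /andP[uqs _] zs.
have zu : z != u.
  by apply: contraTneq uqp => <-; rewrite /= pE mem_cat mem_head orbT.
have usz : path (implies F) u (rcons s z).
  by move: up; rewrite pE -cat_rcons cat_path => /andP[].
have : ~~ good (vars (u :: s)) q.
  case/lastP: q ql {qP} => [|q y].
    by move=> /= /eqP; rewrite eq_sym (negbTE (neg_neq u)).
  by rewrite last_rcons => <-; rewrite /good all_rcons inE eqxx /= andbF.
case/first_bad=> t [y [r' [qE gt yt]]].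
have uty : path (implies F) (neg u) (rcons t y).
  by move: qP; rewrite qE -cat_rcons cat_path => /andP[].
have := path_implies_rev_neg uty; rewrite negK => ytu.
set W := rev (map neg t) ++ u :: s.
have WP : path (implies F) (neg y) (rcons W z).
  by rewrite /W rcons_cat rcons_cons -cat_rcons cat_path ytu last_rcons.
have varsW : vars W = rev (vars t) ++ vars (u :: s).
  by rewrite /W map_cat map_rev -map_comp.
have uqW : uniq (vars W).
  case/andP: gt => ut /allP at_; rewrite varsW cat_uniq rev_uniq ut uqs andbT.
  apply/hasPn => v vs; rewrite mem_rev; apply/negP => /mapP[x /at_ + vE].
  by rewrite -vE vs.
have zW : z.1 \in vars W by rewrite varsW mem_cat zs orbT.
have yW : (neg y).1 \in vars W by rewrite varsW mem_cat mem_rev orbC -mem_cat.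
have lW : last (neg y) W = last u s by rewrite /W last_cat.
(* These inequalities rule out that the end arcs coincide, or are contrapositive to each other. *)
have hW : head u W != z /\ head u W != neg (last u s).
  rewrite /W; case/lastP: {+}t gt => [|t' x] gt /=.
    split; first by rewrite eq_sym.
    apply/eqP => e; have : last u s = u.
      apply: (eq_lit_of_uniq uqs) (mem_last _ _) (mem_head _ _) _.
      by rewrite -[LHS]/((neg (last u s)).1) -e.
    by move=> lu; have := neg_neq u; rewrite -{1}lu -e eqxx.
  rewrite map_rcons rev_rcons /=.
  have xs : x.1 \notin vars (u :: s).
    by case/andP: gt => _; rewrite all_rcons => /andP[].
  split; first by apply: contraNneq xs => e; rewrite -[x.1]/(neg x).1 e.
  apply: contraNneq xs => /(congr1 neg); rewrite !negK => ->.
  by rewrite (map_f fst) ?mem_last.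
have : (size W <= n + m)%N.
  rewrite -(size_map fst) -(card_uniqP uqW) -[(n + m)%N](_ : #|{: var}| = _) ?max_card //.
  by rewrite card_sum !card_ord.
case: W WP varsW uqW zW yW lW hW => [|w s'] WP varsW uqW zW yW lW [hz hl] sW.
  by move/(congr1 size): varsW; rewrite size_cat /= addnS.
exists (size s'), w; split=> //.
move: (WP); rewrite rcons_cons /= => /andP[yw ws]; move: (ws); rewrite rcons_path => /andP[ws' sz].
apply/hasP; exists (s', (neg y, z)); last first.
  by rewrite /bicycle_clauses /= -path_implies ?(path_implies_bip WP).
apply: allpairs_f_dep; rewrite mem_filter ?uqW ?mem_walks ?eqxx ?(path_implies_bip ws') //.
rewrite allpairs_f ?mem_closers // andbT /=.
rewrite /bip (implies_arc yw) (implies_arc sz) /=; apply/eqP => e.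
case: (arc_inj (implies_arc yw) e) => -[_ e'].
  by case/eqP: hz.
by case/eqP: hl; rewrite -lW.
Qed.

End ImplicationDigraph.

(** * Estimates for random formulas *)

Section RealEstimates.
Variable R : realFieldType.
Implicit Types (p t r rho q : R) (k N : nat).

(** With [s = N t] this says [1 - (1 - t)^N <= s / (1 + s / 4)], a second-order gain over the union
    bound [s]. *)
Lemma one_sub_exp_ge t N : 0 <= t <= 1 -> (1 < N)%N ->
  1 - 3 / 4 * (N%:R * t) <= (1 - t) ^+ N * (1 + N%:R * t / 4).
Proof.
move=> /andP[t0 t1]; elim: N => // -[//|[|N]] IH _; first by nra.
have {}IH := IH isT; set M := N.+2 in IH *.
have M2 : 2 <= M%:R :> R by rewrite ler_nat.
rewrite exprSr -[M.+1%:R]natr1; set x : R := M%:R in IH M2 *.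
have e0 : 0 <= (1 - t) ^+ M by rewrite exprn_ge0 // subr_ge0.
set e := _ ^+ M in IH e0 *.
have [neg|pos] := lerP (1 - 3 / 4 * ((x + 1) * t)) 0.
  apply: le_trans neg _; apply: mulr_ge0; first by rewrite mulr_ge0 // subr_ge0.
  nra.
have d0 : 0 < 1 + x * t / 4 by nra.
rewrite -(ler_pM2r d0).
apply: le_trans (_ : (1 - 3 / 4 * (x * t)) * ((1 - t) * (1 + (x + 1) * t / 4)) <= _).
  have s0 : 0 <= t * t * (8 * x - 4) by apply: mulr_ge0; [exact: mulr_ge0|lra].
  have c0 : 0 <= t * t * t * (x * (x + 1)).
    by apply: mulr_ge0; [rewrite !mulr_ge0|nra].
  nra.
apply: le_trans (_ : (e * (1 + x * t / 4)) * ((1 - t) * (1 + (x + 1) * t / 4)) <= _).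
  apply: ler_wpM2r => //; apply: mulr_ge0; [lra|nra].
by rewrite le_eqVlt; apply/orP; left; apply/eqP; ring.
Qed.

(** The probability that a branching process with Binomial([N], [p]) offspring reaches generation
    [k]. *)
Fixpoint survival p N k : R := if k is k'.+1 then 1 - (1 - p * survival p N k') ^+ N else 1.

Lemma survival_bound p N k : 0 <= p <= 1 -> 0 <= survival p N k <= 1.
Proof.
move=> /andP[p0 p1]; elim: k => [|k /andP[s0 s1]] /=; first by rewrite ler01 lexx.
have h0 : 0 <= p * survival p N k by rewrite mulr_ge0.
have h1 : p * survival p N k <= 1 by apply: mulr_ile1.
rewrite subr_ge0 exprn_ile1 ?subr_ge0 //; last by rewrite gerBl.
by rewrite gerBl exprn_ge0 ?subr_ge0.
Qed.

(** By [one_sub_exp_ge] the reciprocal of the survival probability grows by at least 1/4 per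
    generation when [rho = 1], which gives [4 / k]; in general each generation costs a further
    factor [rho]. *)
Lemma survival_decay p rho N k : 0 <= p <= 1 -> (1 < N)%N -> 1 <= rho ->
  N%:R * p <= rho -> k%:R * survival p N k <= 4 * rho ^+ k.
Proof.
move=> hp N2 r1 Np; elim: k => [|k IH].
  by rewrite mul0r mulr_ge0 // exprn_ge0 // (le_trans ler01).
have /andP[q0 q1] := survival_bound N k hp; rewrite /=.
have /andP[p0 p1] := hp.
set q := survival p N k in IH q0 q1 *.
have pq : 0 <= p * q <= 1 by rewrite mulr_ge0 // mulr_ile1.
have := one_sub_exp_ge pq N2; set e := _ ^+ N.
set s := N%:R * (p * q) => H.
have s0 : 0 <= s by rewrite /s mulr_ge0 //; case/andP: pq.
have sq : s <= rho * q by rewrite /s mulrA ler_wpM2r.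
have E1 : 1 <= rho ^+ k.+1 by rewrite exprn_ege1.
have ks : k%:R * s <= 4 * rho ^+ k.+1.
  apply: le_trans (ler_wpM2l (ler0n _ k) sq) _.
  rewrite exprS mulrCA [leRHS]mulrCA; apply: ler_wpM2l => //.
  exact: le_trans ler01 r1.
have d0 : 0 < 1 + s / 4 by lra.
rewrite -[k.+1%:R]natr1 -(ler_pM2r d0).
have e1 : (1 - e) * (1 + s / 4) <= s by lra.
have k0 : 0 <= k%:R + 1 :> R by rewrite addr_ge0.
apply: le_trans (_ : (k%:R + 1) * s <= _); first by rewrite -mulrA; apply: ler_wpM2l.
have : s <= rho ^+ k.+1 * s by rewrite ler_peMl.
by move: (rho ^+ k.+1) ks => E ks; lra.
Qed.

Lemma sum_sqr_geom_le r k : 0 <= r < 1 ->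
  \sum_(0 <= j < k) j.+1%:R ^+ 2 * r ^+ j.+1 <= 3 / (1 - r) ^+ 3.
Proof.
move=> /andP[r0 r1]; set d := 1 - r.
have d0 : 0 < d by rewrite subr_gt0.
have d1 : d <= 1 by rewrite /d; lra.
pose i := d^-1; have i1 : 1 <= i by rewrite invf_ge1.
have di : d * i = 1 by rewrite mulfV // gt_eqF.
(* A majorant of the tail of the series from index [j] on: the drop from [a j] to [a j.+1] pays for
   the term [j^2 r^j], so the sum telescopes. *)
pose a j : R := r ^+ j * (i * j%:R ^+ 2 + 2 * i ^+ 2 * j%:R + (i ^+ 2 + 2 * i ^+ 3)).
suff H : \sum_(0 <= j < k) j.+1%:R ^+ 2 * r ^+ j.+1 + a k.+1 <= 3 / d ^+ 3.
  apply: le_trans H; rewrite lerDl mulr_ge0 ?exprn_ge0 //.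
  by rewrite !addr_ge0 // ?mulr_ge0 ?exprn_ge0 // ?(le_trans ler01).
have aS j : j%:R ^+ 2 * r ^+ j + a j.+1 <= a j.
  rewrite /a [r ^+ j.+1]exprS -[j.+1%:R]natr1; set x : R := j%:R.
  have x0 : 0 <= x by exact: ler0n.
  have e0 : 0 <= r ^+ j by exact: exprn_ge0.
  set e := r ^+ j in e0 *.
  rewrite -subr_ge0; set D := _ - _; have -> : D =
     e * ((d * i - 1) * x ^+ 2 + 2 * (d * i * i - r * i) * x
      + (d * i * (i + 2 * i ^+ 2) - r * (i + 2 * i ^+ 2))) by rewrite /D /d; ring.
  rewrite di subrr mul0r add0r !mul1r; apply: mulr_ge0 => //.
  have i0 : 0 <= i by exact: le_trans ler01 i1.
  have h1 : 0 <= i - r * i by nra.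
  have h2 : 0 <= (i + 2 * i ^+ 2) by nra.
  by apply: addr_ge0; [rewrite !mulr_ge0|nra].
elim: k => [|k IH].
  rewrite big_geq // add0r; apply: le_trans (_ : a 0%N <= _).
    by have := aS 0%N; rewrite expr0n mul0r add0r.
  rewrite /a expr0 mul1r expr0n !mulr0 !add0r -exprVn -/i.
  have : i ^+ 2 <= i ^+ 3 by rewrite [i ^+ 3]exprS ler_peMl // exprn_ge0 // (le_trans ler01).
  lra.
rewrite big_nat_recr //=; apply: le_trans IH.
by rewrite -addrA lerD2l aS.
Qed.

End RealEstimates.

(** * Exploration, spine pairs and bicycles in a random formula *)

Section RandomFormula.
Variables (R : realFieldType) (n m : nat).

Notation var := ('I_n + 'I_m)%type.
Notation lit := (var * bool)%type.
Notation clause := (bipartite_clause n m).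
Notation formula := (bipartite_formula n m).
Notation vars := (map (@fst var bool)).
Notation N := (degree n m).
Implicit Types (F G : formula) (c : clause) (u v x y z : lit) (s t : seq lit).
Implicit Types (U : seq var) (p q : R).

(** Asks recursively for a self-avoiding walk of length [k] off [U]. Adding each source to the
    forbidden set makes the event at a child independent of the clause leading to it. *)
Fixpoint deep k x U F : bool :=
  if k is k'.+1 then
    has (fun z => [&& implies F x z, z.1 \notin x.1 :: U & deep k' z (x.1 :: U) F]) (nbrs x)
  else true.

Lemma deep_increasing k x U : increasing (deep k x U).
Proof.
elim: k x U => //= k IH x U F G FG; apply: sub_has => z /and3P[xz -> dz].
by rewrite (implies_sub FG xz) (IH _ _ _ _ FG dz).
Qed.

Lemma deep_of_walk k x U F s : size s = k -> good U (x :: s) ->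
  path (implies F) x s -> deep k x U F.
Proof.
elim: k x U s => //= k IH x U [|z s] //= [sk] /andP[/= /andP[xs /andP[zs us]]].
move=> /and3P[xU zU sU] /andP[xz zP]; apply/hasP; exists z.
  by rewrite mem_nbrs; apply: implies_arc xz.
move: xs; rewrite xz inE negb_or eq_sym => /andP[xz1 xs] /=.
rewrite inE negb_or xz1 zU (IH z (x.1 :: U) s) //.
rewrite /good /= zs us inE negb_or xz1 zU /=.
apply/allP => v vs; rewrite inE negb_or (allP sU) // andbT.
by apply: contraNneq xs => <-; apply: map_f.
Qed.

(** The exploration uses only arcs with both ends off [U], whereas the clause [c] involves the
    variable of [u]. *)
Lemma deep_indep k z U F c u v : arc u v = Some c -> u.1 \in U -> z.1 \notin U ->
  deep k z U (c |: F) = deep k z U F.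
Proof.
move=> uv; elim: k z U => //= k IH z U uU zU; apply: eq_has => y.
case: (boolP (y.1 \notin z.1 :: U)) => [yU|]; rewrite ?andbF //.
rewrite /= IH //; last by rewrite inE uU orbT.
congr (_ && _); rewrite /implies; case E: (arc z y) => [d|] //.
rewrite !inE; case: eqP => //= dc; exfalso.
have uv' : arc u v by rewrite uv.
have := arc_inj uv' (y := y) (x := z); rewrite uv E dc => /(_ erefl) [[uz _]|[uy _]].
  by move: zU; rewrite -uz uU.
by move: yU; rewrite inE negb_or -[y.1]/(neg y).1 -uy uU andbF.
Qed.

Variable p : R.
Hypothesis p01 : 0 <= p <= 1.

Let w : clause -> R := fun=> p.

Lemma cst_weight : weight w. Proof. by []. Qed.
Let hw := cst_weight.

(** The branches are not independent, but their failures are decreasing events, so by Harris all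
    fail with at least the product probability, as in the branching recursion. *)
Lemma prob_deep k x U : prob w (deep k x U) <= survival p N k.
Proof.
elim: k x U => [|k IH] x U /=; first exact: prob_le1.
have /andP[s0 s1] := survival_bound N k p01; have /andP[p0 p1] := p01.
have ps1 : p * survival p N k <= 1 by apply: mulr_ile1.
pose E z : pred formula :=
  fun F => [&& implies F x z, z.1 \notin x.1 :: U & deep k z (x.1 :: U) F].
have Eb z : prob w (E z) <= p * survival p N k.
  rewrite /E; case: (boolP (z.1 \notin x.1 :: U)) => zU /=; last first.
    rewrite (prob_ext w (B := xpred0)) ?prob0 ?mulr_ge0 // => F.
    by rewrite andbF.
  rewrite /implies; case xz : (arc x z) => [c|]; last by rewrite prob0 mulr_ge0.
  rewrite prob_mem_and; first by rewrite ler_wpM2l.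
  by move=> F; apply: deep_indep xz _ zU; rewrite mem_head.
rewrite (prob_ext w (B := fun F => ~~ all (fun z => ~~ E z F) (nbrs x))); last first.
  by move=> F; rewrite -has_predC; apply: eq_has => z; rewrite /= negbK.
rewrite prob_compl lerD2l lerN2.
apply: le_trans (prob_all_decreasing (nbrs x) hw (E := fun z F => ~~ E z F) _).
  apply: le_trans (_ : (1 - p * survival p N k) ^+ size (nbrs x) <= _).
    apply: ler_wiXn2l; rewrite ?subr_ge0 ?gerBl ?mulr_ge0 //.
    exact: size_nbrs.
  elim: (nbrs x) => [|z l IHl]; first by rewrite big_nil.
  rewrite big_cons exprS ler_pM ?exprn_ge0 ?subr_ge0 //.
  by rewrite prob_compl lerD2l lerN2.
move=> z F G FG; apply: contra => /and3P[xz zU dz].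
by rewrite /E (implies_sub FG xz) zU (deep_increasing FG dz).
Qed.

Lemma prob_clauses (C : {set clause}) : prob w (fun F => C \subset F) = p ^+ #|C|.
Proof. by rewrite prob_subset prodr_const. Qed.

Lemma prob_has_clauses (I : eqType) (l : seq I) (C : I -> {set clause}) k b :
  {in l, forall i, #|C i| = k} -> (size l <= b)%N ->
  prob w (fun F => has (fun i => C i \subset F) l) <= b%:R * p ^+ k.
Proof.
move=> Ck lb; have /andP[p0 p1] := p01.
apply: le_trans (prob_has _ (fun i F => C i \subset F) hw) _.
rewrite big_seq (eq_bigr (fun=> p ^+ k)); last first.
  by move=> i il; rewrite prob_clauses Ck.
rewrite -big_seq big_const_seq count_predT iter_addr_0 -[p ^+ k *+ _]mulr_natl.
by rewrite ler_wpM2r ?exprn_ge0 // ler_nat.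
Qed.

Lemma size_hit_witnesses j U x :
  (size (hit_witnesses j U x) <= N ^ j * (2 * (size U + j.+1)))%N.
Proof.
rewrite size_allpairs_dep.
apply: leq_trans (sumn_map_le (b := (2 * (size U + j.+1))%N) _) _ => [s|].
  rewrite mem_filter mem_walks => /and3P[_ /eqP sj _].
  rewrite size_filter; apply: leq_trans (count_size _ _) _.
  by rewrite size_closers size_cat /= size_map sj.
rewrite leq_mul2r size_filter (leq_trans (count_size _ _)) ?orbT //.
exact: size_walks.
Qed.

(** Long witnesses are bounded by survival. For hitting witnesses a union bound over [j < k] counts
    at most [N^j] walks, with [2 (size U + j + 1)] closing literals, each present with probability
    [p^(j+1)]. *)
Lemma prob_escape k U x rho : 1 <= rho -> N%:R * p <= rho ->
  prob w (escape k U x) <=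
  survival p N k + k%:R * (2 * (size U + k)%:R * (p * rho ^+ k)).
Proof.
move=> r1 Np; have /andP[p0 p1] := p01.
apply: le_trans (_ : prob w (fun F => deep k x U F ||
  has (fun j => has (fun t => clauses x t \subset F) (hit_witnesses j U x)) (iota 0 k)) <= _).
  apply: prob_le => // F; rewrite /escape has_cat => /orP[/hasP[s]|].
    rewrite mem_filter mem_walks => /andP[gs /andP[/eqP sk xs]].
    by rewrite -path_implies // => /(deep_of_walk sk gs) ->.
  move=> /hasP[t /flattenP[l /mapP[j jk ->]] tl tF]; apply/orP; right.
  by apply/hasP; exists j => //; apply/hasP; exists t.
apply: le_trans (prob_or _ _ hw) _; apply: lerD; first exact: prob_deep.
apply: le_trans (prob_has _ (fun j F => has _ (hit_witnesses j U x)) hw) _.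
have -> : k%:R * (2 * (size U + k)%:R * (p * rho ^+ k)) =
    \sum_(j <- iota 0 k) (2 * (size U + k)%:R * (p * rho ^+ k)).
  by rewrite big_const_seq count_predT size_iota iter_addr_0 mulr_natl.
rewrite big_seq [leRHS]big_seq.
apply: ler_sum => j; rewrite mem_iota /= add0n => jk.
apply: le_trans (prob_has_clauses (k := j.+1) _ (size_hit_witnesses j U x)) _.
  move=> t tw; have tk : t \in witnesses k U x.
    rewrite mem_cat; apply/orP; right; apply/flattenP.
    by exists (hit_witnesses j U x) => //; apply: map_f; rewrite mem_iota.
  rewrite (card_witness tk); case/hit_witnessesP: tw => s [z [-> <- _ _ _]].
  by rewrite size_rcons.
have -> : (N ^ j * (2 * (size U + j.+1)))%:R * p ^+ j.+1 =
    (2 * (size U + j.+1))%:R * (p * (N%:R * p) ^+ j) :> R.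
  by rewrite natrM natrX exprMn exprS; ring.
have Np0 : 0 <= N%:R * p by rewrite mulr_ge0.
apply: ler_pM => //; first by rewrite mulr_ge0 ?exprn_ge0.
  by rewrite -natrM ler_nat leq_mul2l leq_add2l jk.
rewrite ler_wpM2l //; apply: le_trans (_ : rho ^+ j <= _).
  by rewrite lerXn2r // nnegrE ?mulr_ge0 // (le_trans ler01).
by rewrite ler_weXn2l // ltnW.
Qed.

Definition spine_pair c F : bool := spine (first_lit c) F && spine (second_lit c) F.

Lemma sum_var_mem (ys : seq lit) U : uniq ys ->
  \sum_(y <- ys) (y.1 \in U)%:R <= (2 * size U)%:R :> R.
Proof.
move=> uy; rewrite -natr_sum ler_nat -big_mkcond sum1_count -size_filter -size_closers.
apply: uniq_leq_size; first exact: filter_uniq.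
by move=> y; rewrite mem_filter mem_closers => /andP[].
Qed.

(* Either [y] lies on the first witness W found for [x], or [y] escapes from
   outside W; given W, the latter is not more likely than unconditionally. *)
Lemma sum_prob_spines k x (ys : seq lit) (b : R) : uniq ys ->
  (forall y U, (size U <= k.+1)%N -> prob w (escape k U y) <= b) ->
  \sum_(y <- ys) prob w (fun F => spine x F && spine y F) <=
  b * ((2 * k.+1)%:R + (size ys)%:R * b).
Proof.
move=> uy eb.
pose W := witnesses k [::] x.
pose on y t : pred formula := fun=> y.1 \in vars (x :: t).
pose off y t : pred formula := escape k (vars (x :: t)) y.
pose fw E F := first_witness (clauses x) E W F.
have tk t : t \in W -> (size (vars (x :: t)) <= k.+1)%N.
  by move=> tW; rewrite size_map /= ltnS (witnesses_size tW).
have split y F : spine x F && spine y F -> fw (on y) F || fw (off y) F.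
  case/andP=> /(spine_escape k (U := [::]) isT); rewrite /escape -/W /fw => + yF.
  elim: (W) => //= t l IH; case: (clauses x t \subset F) => //= _.
  rewrite /on; case: (boolP (y.1 \in vars (x :: t))) => //= yt.
  exact: spine_escape.
have b0 : 0 <= b.
  exact: le_trans (prob_ge0 _ hw) (eb x [::] isT).
apply: le_trans (_ : \sum_(y <- ys) (prob w (fw (on y)) + prob w (fw (off y))) <= _).
  apply: ler_sum => y _; apply: le_trans (prob_or _ _ hw).
  by apply: prob_le => // F; apply: split.
rewrite big_split mulrDr; apply: lerD.
  (* For each formula at most [2 (k + 1)] literals lie on the first witness, and none do unless [x]
     escapes. *)
  rewrite -expect_sum; apply: le_trans (_ : expect w (fun F =>
    (2 * k.+1)%:R * (escape k [::] x F)%:R) <= _).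
    apply: expect_le => // F; rewrite /fw /escape -/W.
    elim: (W) tk => [|t l IH] tk /=; first by rewrite big1 ?mulr0.
    case: (clauses x t \subset F) => /=; last first.
      by apply: IH => s sl; apply: tk; rewrite inE sl orbT.
    rewrite mulr1; apply: le_trans (sum_var_mem _ uy) _.
    by rewrite ler_nat leq_mul2l tk ?mem_head.
  by rewrite expectZ mulrC ler_wpM2r // eb.
apply: le_trans (_ : \sum_(y <- ys) b * b <= _); last first.
  by rewrite big_const_seq count_predT iter_addr_0 -[b * b *+ _]mulr_natl mulrCA.
apply: ler_sum => y _.
apply: le_trans (_ : b * prob w (escape k [::] x) <= _); last by rewrite ler_wpM2l // eb.
apply: prob_first_witness => // t tW.
- exact: escape_increasing.
- by move=> F; apply: escape_indep.
- by apply: eb; apply: tk.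
Qed.

Lemma sum_prob_spine_pair k (b : R) : 0 <= b ->
  (forall y U, (size U <= k.+1)%N -> prob w (escape k U y) <= b) ->
  \sum_c prob w (spine_pair c) <= N%:R * (b * ((2 * k.+1)%:R + N%:R * b)).
Proof.
move=> b0 eb.
have card_lit a : (a <= maxn n m)%N -> (#|{: literal a}| <= N)%N.
  by move=> am; rewrite card_prod card_ord card_bool mulnC leq_mul2l.
pose ys : seq lit := [seq (inr l.1, l.2) | l <- enum {: literal m}].
have uy : uniq ys.
  rewrite map_inj_uniq ?enum_uniq // => -[i a] [j c] /= [] -> -> //.
have sy : (size ys <= N)%N by rewrite size_map -cardE card_lit ?leq_maxr.
rewrite (eq_bigr (fun c => prob w (spine_pair (c.1, c.2)))); last by case.
rewrite -(pair_bigA _ (fun l l' => prob w (spine_pair (l, l')))) /=.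
apply: le_trans (_ : \sum_(l : literal n) b * ((2 * k.+1)%:R + N%:R * b) <= _).
  apply: ler_sum => l _.
  have := sum_prob_spines (inl l.1, l.2) uy eb; rewrite big_map big_enum.
  move/le_trans; apply; rewrite ler_wpM2l // lerD2l ler_wpM2r // ler_nat //.
rewrite sumr_const -[X in X <= _]mulr_natl ler_wpM2r ?mulr_ge0 ?addr_ge0 ?mulr_ge0 //.
by rewrite ler_nat card_lit ?leq_maxl.
Qed.

Lemma prob_unsatisfiable : N%:R * p < 1 ->
  prob w (fun F => ~~ satisfiable F) <= 24 * p / (1 - N%:R * p) ^+ 3.
Proof.
move=> Np1; have /andP[p0 p1] := p01.
apply: le_trans (_ : prob w (fun F => has (fun k => has (fun x =>
  has (fun b => bicycle_clauses x b \subset F) (bicycles_at k x)) (enum {: lit}))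
  (index_iota 0 (n + m))) <= _).
  apply: prob_le => // F /unsatisfiable_bicycle[k [x [kn h]]].
  apply/hasP; exists k; first by rewrite mem_index_iota.
  by apply/hasP; exists x; rewrite ?mem_enum.
apply: le_trans (prob_has _ (fun k F => has _ (enum {: lit})) hw) _.
have r0 : 0 <= N%:R * p by rewrite mulr_ge0.
apply: le_trans (_ : \sum_(0 <= k < n + m) 8 * p * (k.+1%:R ^+ 2 * (N%:R * p) ^+ k.+1) <= _).
  apply: ler_sum => k _.
  apply: le_trans (prob_has _ (fun x F => has _ (bicycles_at k x)) hw) _.
  apply: le_trans (_ : \sum_(x : lit) (N ^ k * (2 * k.+1) ^ 2)%:R * p ^+ k.+2 <= _).
    rewrite big_enum; apply: ler_sum => x _.
    apply: prob_has_clauses (size_bicycles_at k x) => b.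
    exact: card_bicycle.
  rewrite sumr_const -[X in X <= _]mulr_natl.
  have -> : 8 * p * (k.+1%:R ^+ 2 * (N%:R * p) ^+ k.+1) =
      (2 * N)%:R * ((N ^ k * (2 * k.+1) ^ 2)%:R * p ^+ k.+2) :> R.
    rewrite !natrM !natrX natrM !exprS exprMn; ring.
  apply: ler_wpM2r; first by rewrite mulr_ge0 ?exprn_ge0.
  (* There are [2 (n + m) <= 2 N] starting literals. *)
  rewrite ler_nat card_prod card_bool card_sum !card_ord mulnC leq_mul2l /=.
  by rewrite /degree mul2n -addnn leq_add ?leq_maxl ?leq_maxr.
rewrite -mulr_sumr.
have := sum_sqr_geom_le (n + m) (_ : 0 <= N%:R * p < 1); rewrite r0 Np1 => /(_ isT) H.
have := ler_wpM2l (_ : 0 <= 8 * p) H; rewrite mulr_ge0 // => /(_ isT).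
move/le_trans; apply; rewrite mulrA; apply: ler_wpM2r; last by lra.
by rewrite invr_ge0 exprn_ge0 // subr_ge0 ltW.
Qed.

End RandomFormula.

(** * Raising clause probabilities one at a time *)

Section Sprinkling.
Variables (R : realFieldType) (n m : nat).
Notation clause := (bipartite_clause n m).
Implicit Types (F : bipartite_formula n m) (c : clause) (w : clause -> R) (p : R).

(* Given satisfiability, adding [c] to [F :\ c] is fatal only if both literals
   of [c] are on the spine of [F :\ c], an increasing event; by Harris it is not
   more likely than unconditionally. *)
Lemma prob_satisfiable_step w w' p c : weight w -> weight w' -> 0 <= p <= 2^-1 ->
  (forall d, w d <= p) -> w' c = p -> (forall d, d != c -> w' d = w d) ->
  prob w (@satisfiable n m) * (1 - 2 * (p - w c) * prob (fun=> p) (spine_pair c)) <=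
  prob w' (@satisfiable n m).
Proof.
move=> hw hw' /andP[p0 p2] wp w'c w'd.
have hp : weight (fun _ : clause => p) by move=> d; rewrite p0; lra.
set pi := prob _ (spine_pair c).
have pi0 : 0 <= pi by apply: prob_ge0.
have pi1 : pi <= 1 by apply: prob_le1.
rewrite {1 2}/prob (expect_split w c) (expect_split w' c) w'c.
have agree f : expect_off w' c f = expect_off w c f by apply: expect_off_agree.
pose sat F : R := (satisfiable F)%:R.
rewrite !agree (expect_off_setU1 w c sat) (expect_off_setD1 w c sat) /sat.
set a1 := expect w _; set a0 := expect w _.
have a1_0 : 0 <= a1 by apply: (prob_ge0 (fun F => satisfiable (c |: F)) hw).
have a0_0 : 0 <= a0 by apply: (prob_ge0 (fun F => satisfiable (F :\ c)) hw).
(* The left side is the probability that adding [c] destroys satisfiability. *)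
have key : a0 - a1 <= a0 * pi.
  rewrite -expectB.
  apply: le_trans (_ : prob w (fun F => spine_pair c (F :\ c) && satisfiable (F :\ c)) <= _).
    apply: expect_le => // F; rewrite /spine_pair.
    case: (boolP (satisfiable (F :\ c))) => [sF|nF]; last by rewrite andbF sub0r oppr_le0.
    rewrite andbT; case: (boolP (satisfiable (c |: F))) => [_|nF]; first by rewrite subrr.
    rewrite subr0 ler_nat lt0b; apply: contraR nF; rewrite negb_and.
    exact: satisfiable_setU1.
  have inc : increasing (fun F => spine_pair c (F :\ c)).
    move=> F G FG /andP[h1 h2].
    by rewrite /spine_pair !(spine_increasing (setSD _ FG)).
  apply: le_trans (prob_increasing_decreasing hw inc _) _.
    by move=> F G FG; apply: satisfiable_decreasing; apply: setSD.
  rewrite mulrC ler_wpM2l //.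
  apply: le_trans (_ : prob w (spine_pair c) <= _).
    apply: prob_le => // F /andP[h1 h2].
    by rewrite /spine_pair !(spine_increasing (subD1set F c)).
  apply: prob_weight_le => // F G FG /andP[h1 h2].
  by rewrite /spine_pair !(spine_increasing FG).
have wc := wp c; have /andP[wc0 wc1] := hw c.
set q := w c in wc wc0 wc1 *.
have d0 : 0 <= p - q by rewrite subr_ge0.
have pa : 0 <= (p - q) * pi by rewrite mulr_ge0.
have h1 := ler_wpM2l d0 key.
(* As [q <= 1/2], the formula lacks [c] with probability at least 1/2; this turns the loss into a
   relative one and produces the factor 2. *)
have h2 : a0 <= 2 * (q * a1 + (1 - q) * a0).
  have : 0 <= (1 - 2 * q) * a0 by rewrite mulr_ge0 //; lra.
  have : 0 <= q * a1 by rewrite mulr_ge0.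
  lra.
have h3 := ler_wpM2l pa h2.
move: h1 h3; rewrite mulrBr; lra.
Qed.

Lemma prob_satisfiable_sprinkle (p q : R) : 0 <= q -> q <= p -> p <= 2^-1 ->
  prob (fun=> q) (@satisfiable n m) *
    \prod_(c : clause) (1 - 2 * (p - q) * prob (fun=> p) (spine_pair c)) <=
  prob (fun=> p) (@satisfiable n m).
Proof.
move=> q0 qp p2; have p0 := le_trans q0 qp.
have hp : weight (fun _ : clause => p) by move=> d; rewrite p0; lra.
(* The clauses in [s] have already been raised; all weights stay below [p], so spine events can be
   compared with the measure at [p]. *)
pose w (s : seq clause) c := if c \in s then p else q.
have hw s : weight (w s) by move=> d; rewrite /w; case: ifP => _; lra.
have f0 c : 0 <= 1 - 2 * (p - q) * prob (fun=> p) (spine_pair c).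
  have h0 := prob_ge0 (spine_pair c) hp; have h1 := prob_le1 (spine_pair c) hp.
  have : (p - q) * prob (fun=> p) (spine_pair c) <= (p - q) * 1.
    by rewrite ler_wpM2l // subr_ge0.
  lra.
have H s : uniq s -> prob (fun=> q) (@satisfiable n m) *
    \prod_(c <- s) (1 - 2 * (p - q) * prob (fun=> p) (spine_pair c)) <=
    prob (w s) (@satisfiable n m).
  elim: s => [|c s IH] /=; first by rewrite big_nil mulr1.
  move=> /andP[cs us]; rewrite big_cons mulrCA [leLHS]mulrC.
  have wc : w s c = q by rewrite /w (negbTE cs).
  apply: le_trans (ler_wpM2r (f0 c) (IH us)) _; rewrite -{1}wc.
  apply: prob_satisfiable_step => //; first by rewrite p0.
  - by move=> d; rewrite /w; case: ifP.
  - by rewrite /w mem_head.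
  - by move=> d dc; rewrite /w inE (negbTE dc).
have := H (index_enum _) (index_enum_uniq _); move/le_trans; apply.
rewrite le_eqVlt (@prob_weight_ext _ _ (w _) (fun=> p)) ?eqxx // => d.
by rewrite /w mem_index_enum.
Qed.

End Sprinkling.

From mathcomp Require Import all_classical all_reals all_analysis.

(** * The two regimes *)

Section Bounds.
Variables (R : realType) (n m : nat).
Implicit Types (p t d : R).
Notation clause := (bipartite_clause n m).
Notation N := (degree n m).

Lemma prob_satisfiableE p :
  prob_satisfiable n m p = prob (fun=> p) (@satisfiable n m).
Proof.
rewrite /prob_satisfiable /random_subset_prob big_mkcond; apply: eq_bigr => F _.
by case: (satisfiable F); rewrite ?mulr1 ?mulr0.
Qed.

Lemma expR_le_one_sub t : 0 <= t <= 2^-1 -> expR (- (2 * t)) <= 1 - t.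
Proof.
move=> /andP[t0 t2]; have d0 : 0 < 1 - t by lra.
rewrite expRN -[leRHS]invrK lef_pV2 ?posrE ?invr_gt0 ?expR_gt0 //.
apply: le_trans (expR_ge1Dx _).
rewrite -(ler_pM2r d0) mulVf ?gt_eqF //.
have : 0 <= t * (1 - 2 * t) by rewrite mulr_ge0 //; lra.
lra.
Qed.

Lemma prob_satisfiable_subcritical p d : 0 <= p <= 1 -> 0 < d ->
  N%:R * p <= 1 - d -> 24 * p / d ^+ 3 <= 2^-1 ->
  expR (- (48 * p / d ^+ 3)) <= prob_satisfiable n m p.
Proof.
move=> p01 d0 Np h; have /andP[p0 p1] := p01.
have Np1 : N%:R * p < 1 by lra.
have := prob_unsatisfiable p01 Np1; rewrite prob_compl -prob_satisfiableE.
have : 24 * p / (1 - N%:R * p) ^+ 3 <= 24 * p / d ^+ 3.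
  rewrite ler_wpM2l ?mulr_ge0 // lef_pV2 ?posrE ?exprn_gt0 ?subr_gt0 //.
  have e : d <= 1 - N%:R * p by lra.
  by rewrite lerXn2r // nnegrE ltW // (lt_le_trans d0).
have := @expR_le_one_sub (24 * p / d ^+ 3).
rewrite h andbT mulr_ge0 ?invr_ge0 ?exprn_ge0 ?(ltW d0) ?mulr_ge0 // => /(_ isT).
have -> : 2 * (24 * p / d ^+ 3) = 48 * p / d ^+ 3 by rewrite !mulrA -natrM.
lra.
Qed.

(** The 1 pays for the subcritical starting point, the rest for the sprinkling. *)
Definition supercritical_constant : R := 1 + 8 * (20 * expR 1 * (4 + 20 * expR 1)).

Lemma supercritical_constant_gt0 : 0 < supercritical_constant.
Proof.
have e0 := expR_gt0 (1 : R); rewrite /supercritical_constant.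
by rewrite addr_gt0 // !mulr_gt0 // addr_gt0 // mulr_gt0.
Qed.

(** * The supercritical lower bound *)

Section Supercritical.
Variables p d : R.
Hypotheses (p0 : 0 <= p) (d01 : 0 < d < 1) (N8 : (8 <= N)%N).
Hypothesis Np : 1 <= N%:R * p <= 1 + d.
Hypothesis Nd : 48 <= N%:R * d ^+ 3.

Let k := Num.truncn d^-1.
(** The constant is 8 for survival to depth [k] plus 12 for walks that close up. *)
Let b : R := 20 * expR 1 * d.

Lemma depth_itv : 1 <= k%:R :> R /\ 1 <= 2 * (k%:R * d) <= 2.
Proof.
case/andP: d01 => d0 d1; have i1 : 1 <= d^-1 by rewrite invf_ge1 // ltW.
have /andP[kl ku] := @truncn_itv R d^-1 (le_trans ler01 i1).
have k1 : 1 <= k%:R :> R.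
  rewrite ler1n lt0n; apply/eqP => k0.
  by move: ku; rewrite -/k k0 ltNge i1.
have h1 : k%:R * d <= 1 by rewrite -ler_pdivlMr // mul1r.
have h2 : 1 < (k%:R + 1) * d by rewrite -ltr_pdivrMr // mul1r natr1.
have h3 : 1 * d <= k%:R * d by rewrite ler_wpM2r // ltW.
by split=> //; apply/andP; split; lra.
Qed.

Lemma prob_escape_le x U : (size U <= k.+1)%N -> prob (fun _ : clause => p) (escape k U x) <= b.
Proof.
move=> Uk; case/andP: d01 => d0 d1; have [k1 /andP[kd1 kd2]] := depth_itv.
case/andP: Np => Np1 Np2.
have N8' : 8 <= N%:R :> R by rewrite ler_nat.
have Np8 : 8 * p <= N%:R * p by rewrite ler_wpM2r.
have p1 : p <= 1 by lra.
have p01 : 0 <= p <= 1 by rewrite p0.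
have r1 : 1 <= 1 + d by lra.
apply: le_trans (prob_escape p01 k U x r1 Np2) _.
have re : (1 + d) ^+ k <= expR 1.
  apply: le_trans (_ : expR d ^+ k <= _).
    by rewrite lerXn2r ?nnegrE ?expR_ge0 ?expR_ge1Dx //; lra.
  by rewrite -expRM_natl ler_expR; lra.
have r0 : 0 <= (1 + d) ^+ k by rewrite exprn_ge0 //; lra.
have h1 : survival p N k <= 8 * expR 1 * d.
  have := survival_decay k p01 (leq_trans _ N8) r1 Np2; move=> /(_ isT).
  have /andP[s0 _] := survival_bound N k p01.
  have := expR_gt0 (1 : R).
  set s := survival p N k in s0 *; set e := expR 1 in re *; set r := _ ^+ k in re r0 * => e0 ks.
  have : s <= 2 * (k%:R * d) * s by rewrite ler_peMl.
  have : d * (k%:R * s) <= d * (4 * e) by apply: ler_wpM2l; lra.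
  lra.
have h2 : (size U + k)%:R <= 3 * k%:R :> R.
  rewrite -natrM ler_nat mulSn addnC leq_add2l (leq_trans Uk) //.
  by rewrite mul2n -addnn -addn1 leq_add2l -(ler1n R).
(* [p] is at most [2 / N], and [N d^3 >= 1]; this makes the [k^2 p] closing term of order [d]. *)
have h3 : p <= 2 * d ^+ 3.
  have hd : 0 <= d ^+ 3 by rewrite exprn_ge0 // ltW.
  have Nd1 : 1 <= N%:R * d ^+ 3 by apply: le_trans Nd; rewrite ler1n.
  rewrite -[p]mulr1; apply: le_trans (ler_wpM2l p0 Nd1) _.
  by rewrite mulrCA mulrA ler_wpM2r //; lra.
have h4 : k%:R * (2 * (size U + k)%:R * (p * (1 + d) ^+ k)) <= 12 * expR 1 * d.
  apply: le_trans (_ : k%:R * (2 * (3 * k%:R) * (2 * d ^+ 3 * expR 1)) <= _).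
    apply: ler_wpM2l => //; apply: ler_pM; rewrite ?mulr_ge0 //.
      by rewrite ler_wpM2l.
    by apply: ler_pM.
  have -> : k%:R * (2 * (3 * k%:R) * (2 * d ^+ 3 * expR 1)) =
    12 * expR 1 * d * (k%:R * d * (k%:R * d)) by ring.
  rewrite ler_piMr ?mulr_ge0 ?expR_ge0 ?(ltW d0) //.
  by apply: mulr_ile1; lra.
by rewrite /b; lra.
Qed.

Lemma sum_spine_pair_le : \sum_(c : clause) prob (fun=> p) (spine_pair c) <=
  N%:R ^+ 2 * d ^+ 2 * (20 * expR 1 * (4 + 20 * expR 1)).
Proof.
case/andP: d01 => d0 d1; have [k1 /andP[kd1 kd2]] := depth_itv.
case/andP: Np => Np1 Np2.
have N8' : 8 <= N%:R :> R by rewrite ler_nat.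
have Np8 : 8 * p <= N%:R * p by rewrite ler_wpM2r.
have p01 : 0 <= p <= 1 by rewrite p0 /=; lra.
have b0 : 0 <= b by rewrite /b !mulr_ge0 ?expR_ge0 // ltW.
apply: le_trans (sum_prob_spine_pair p01 b0 prob_escape_le) _.
(* The literals on the witness itself number [O(1/d)], which is within [O(N d)] because
   [N d^2 >= 1]. *)
have h : (2 * k.+1)%:R <= 4 * (N%:R * d) :> R.
  have : (2 * k.+1)%:R <= 4 * k%:R :> R.
    rewrite -natrM ler_nat (_ : 4 * k = 2 * (2 * k))%N; last by rewrite mulnA.
    rewrite leq_mul2l /= mul2n -addnn -addn1.
    by rewrite leq_add2l -(ler1n R).
  move/le_trans; apply; rewrite ler_wpM2l //.
  have h3 : 1 <= N%:R * d ^+ 2.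
    have : N%:R * d ^+ 3 <= N%:R * d ^+ 2.
      by rewrite ler_wpM2l // [d ^+ 3]exprS ler_piMl ?exprn_ge0 // ltW.
    by apply: le_trans; apply: le_trans Nd; rewrite ler1n.
  rewrite -(ler_pM2r d0); apply: le_trans (_ : 1 <= _); first by lra.
  by rewrite -mulrA -expr2.
apply: le_trans (_ : N%:R * (b * (4 * (N%:R * d) + N%:R * b)) <= _).
  by rewrite ler_wpM2l // ler_wpM2l // lerD2r.
by rewrite le_eqVlt; apply/orP; left; apply/eqP; rewrite /b; ring.
Qed.

Lemma prob_satisfiable_supercritical :
  expR (- (supercritical_constant * (N%:R * d ^+ 3))) <= prob_satisfiable n m p.
Proof.
case/andP: d01 => d0 d1; case/andP: Np => Np1 Np2.
have N8' : 8 <= N%:R :> R by rewrite ler_nat.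
have N0 : 0 < N%:R :> R by lra.
have d3 : 0 < d ^+ 3 by rewrite exprn_gt0.
(* Sprinkling starts at distance [d] below criticality, where the first-moment bound applies. *)
pose q := (1 - d) / N%:R.
have Nq : N%:R * q = 1 - d by rewrite /q mulrCA mulfV ?gt_eqF // mulr1.
have q0 : 0 <= q by rewrite divr_ge0 //; lra.
have qp : q <= p by rewrite -(ler_pM2l N0) Nq; lra.
have Np8 : 8 * p <= N%:R * p by rewrite ler_wpM2r.
have p4 : p <= 4^-1 by lra.
(* This is where [48 <= N d^3] comes from. *)
have hq : 24 * q / d ^+ 3 <= 2^-1.
  rewrite ler_pdivrMr // -(ler_pM2l N0) mulrCA Nq.
  rewrite mulrCA; move: Nd; set y := N%:R * d ^+ 3 => Ny; lra.
have q1 : 0 <= q <= 1 by rewrite q0 /=; lra.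
have := @prob_satisfiable_subcritical q d q1 d0 _ hq; rewrite Nq => /(_ (lexx _)) Hq.
have p2 : p <= 2^-1 by lra.
rewrite [leRHS]prob_satisfiableE; apply: le_trans (prob_satisfiable_sprinkle n m q0 qp p2).
rewrite -prob_satisfiableE.
pose t (c : clause) := 2 * (p - q) * prob (fun=> p) (spine_pair c).
have hp : weight (fun _ : clause => p) by move=> c; rewrite p0 /=; lra.
have pq0 : 0 <= p - q by rewrite subr_ge0.
have t0 c : 0 <= t c by rewrite /t mulr_ge0 ?prob_ge0 // mulr_ge0.
(* Follows from [p <= 1/4], which rests on [8 <= N]. *)
have t2 c : t c <= 2^-1.
  have h0 := prob_ge0 (spine_pair c) hp; have h1 := prob_le1 (spine_pair c) hp.
  have : (p - q) * prob (fun=> p) (spine_pair c) <= (p - q) * 1 by rewrite ler_wpM2l.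
  rewrite /t; lra.
apply: le_trans (_ : expR (- (48 * q / d ^+ 3)) * \prod_c expR (- (2 * t c)) <= _); last first.
  apply: ler_pM; rewrite ?expR_ge0 ?prodr_ge0 //.
  apply: ler_prod => c _; rewrite expR_ge0 /=.
  by apply: expR_le_one_sub; rewrite t0 t2.
rewrite -expR_sum -expRD ler_expR sumrN -opprD lerN2.
rewrite -mulr_sumr /t -mulr_sumr.
have S := sum_spine_pair_le; set s := \sum_c _ in S *.
have Npq : N%:R * (p - q) <= 2 * d by rewrite mulrBr Nq; lra.
have h1 : 48 * q / d ^+ 3 <= 1 by lra.
set c0 := 20 * expR 1 * (4 + 20 * expR 1) in S.
have c0_0 : 0 <= c0 by rewrite /c0 !(mulr_ge0, addr_ge0) ?expR_ge0.
have h2 : 2 * (2 * (p - q) * s) <= 8 * c0 * (N%:R * d ^+ 3).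
  apply: le_trans (_ : 2 * (2 * (p - q) * (N%:R ^+ 2 * d ^+ 2 * c0)) <= _).
    by rewrite !ler_wpM2l // mulr_ge0.
  have -> : 2 * (2 * (p - q) * (N%:R ^+ 2 * d ^+ 2 * c0)) =
    4 * (N%:R * d ^+ 2 * c0) * (N%:R * (p - q)) by ring.
  have -> : 8 * c0 * (N%:R * d ^+ 3) = 4 * (N%:R * d ^+ 2 * c0) * (2 * d) by ring.
  by apply: ler_wpM2l => //; rewrite !mulr_ge0 ?exprn_ge0 // ltW.
(* The cost at [q] is at most 1, hence at most [N d^3]. *)
apply: le_trans (lerD h1 h2) _; rewrite /supercritical_constant -/c0.
move: Nd; set y := N%:R * d ^+ 3 => Ny; lra.
Qed.

End Supercritical.
End Bounds.

(** * Translation into the scaling parameters *)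

Section Asymptotics.
Variable R : realType.
Implicit Types x y : R.

Lemma powR_expn x y (k : nat) : 0 <= x -> (x `^ y) ^+ k = x `^ (y * k%:R).
Proof. by move=> x0; rewrite -powR_mulrn ?powR_ge0 // powRrM. Qed.

(** Since the probability is at most 1, a lower bound alone determines the exponent up to [O(B)]:
    take minus the logarithm. *)
Lemma prob_satisfiable_ge_expR (n m : nat) (p B : R) : 0 <= p <= 1 ->
  expR (- B) <= prob_satisfiable n m p ->
  exists g : R, `|g| <= B /\ prob_satisfiable n m p = expR (- g).
Proof.
rewrite prob_satisfiableE => p01; set P := prob _ _ => PB.
have P0 : 0 < P by apply: lt_le_trans PB; apply: expR_gt0.
have P1 : P <= 1 by apply: prob_le1.
exists (- ln P); rewrite opprK lnK ?posrE // normrN; split=> //.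
rewrite ler0_norm ?ln_le0 // lerNl -[leLHS]expRK ler_ln ?posrE ?expR_gt0 //.
Qed.

(* Here [a ^+ 3] and [b ^+ 6] stand for [n] and [m * n]. *)
Lemma max_div_le (C a b l e x y : R) : 0 < C -> 2 * C + 2 <= a -> 0 < b ->
  x = a ^+ 3 -> x * y = b ^+ 6 -> `|x - y| <= C * a ^+ 2 -> e = l / b ->
  8 * C + 8 < `|l| ->
  b ^+ 3 <= Num.max x y <= b ^+ 3 * (1 + `|e| / 2).
Proof.
move=> C0 aC b0 xa xy dxy eE lC.
have a0 : 0 < a by lra.
have a20 : 0 < a ^+ 2 by rewrite exprn_gt0.
have a30 : 0 < a ^+ 3 by rewrite exprn_gt0.
have b30 : 0 < b ^+ 3 by rewrite exprn_gt0.
have ha : 2 * (C * a ^+ 2) <= a ^+ 3.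
  by rewrite mulrA exprS ler_wpM2r ?(ltW a20) //; lra.
have hb : b ^+ 6 = b ^+ 3 * b ^+ 3 by rewrite -exprD.
have h6 : a ^+ 3 * a ^+ 3 = a ^+ 6 by rewrite -exprD.
move: dxy; rewrite ler_norml => /andP[d1 d2].
have ylo : a ^+ 3 / 2 <= y by lra.
have yhi : y <= 2 * a ^+ 3 by lra.
have ba : b <= 2 * a.
  have : b ^+ 6 <= (2 * a) ^+ 6.
    rewrite -xy xa; apply: le_trans (_ : a ^+ 3 * (2 * a ^+ 3) <= _).
      by rewrite ler_wpM2l // ltW.
    rewrite exprMn mulrCA h6 ler_wpM2r ?exprn_ge0 ?(ltW a0) // -natrX ler_nat //.
  by rewrite ler_pXn2r // nnegrE ?mulr_ge0 // ltW.
have he : 4 * C <= a * `|e|.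
  rewrite eE normf_div (gtr0_norm b0) mulrA ler_pdivlMr //.
  apply: le_trans (_ : 4 * C * (2 * a) <= _); first by rewrite ler_wpM2l // mulr_ge0 // ltW.
  have : a * (8 * C) <= a * `|l| by rewrite ler_wpM2l ?(ltW a0) //; lra.
  lra.
set h := `|e| in he *; have h0 : 0 <= h by exact: normr_ge0.
(* The imbalance between [x] and [y] is a relative error of at most [h / 2]; the lower bound on
   [|l|] serves this. *)
have gap : C * a ^+ 2 <= a ^+ 3 / 2 * (h / 2).
  have := ler_wpM2r (ltW a20) he; have -> : a * h * a ^+ 2 = a ^+ 3 * h by rewrite mulrAC -exprS.
  lra.
have gapx : a ^+ 3 / 2 * (h / 2) <= x * (h / 2) by rewrite ler_wpM2r //; lra.
have gapy : a ^+ 3 / 2 * (h / 2) <= y * (h / 2) by rewrite ler_wpM2r //; lra.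
have x0 : 0 <= x by lra.
have y0 : 0 <= y by lra.
(* With [t] the larger factor, compare [t * t] with [s * t] from both sides and take square
   roots. *)
suff H s t : 0 <= s -> s <= t -> t <= s * (1 + h / 2) -> s * t = b ^+ 6 ->
    b ^+ 3 <= t <= b ^+ 3 * (1 + h / 2).
  have [xley|yltx] := leP x y.
    by apply: (H x y) => //; lra.
  by apply: (H y x) => //; [exact: ltW|lra|rewrite mulrC].
move=> s0 st ts stE; have t0 : 0 <= t by exact: le_trans s0 st.
have sq u v : 0 <= u -> 0 <= v -> u * u <= v * v -> u <= v.
  by move=> u0 v0; rewrite -!expr2 ler_pXn2r.
have h10 : 0 <= 1 + h / 2 by rewrite addr_ge0 // divr_ge0.
have b30' := ltW b30.
apply/andP; split; apply: sq => //.
- by rewrite -hb -stE ler_wpM2r.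
- by rewrite mulr_ge0.
apply: le_trans (ler_wpM2r t0 ts) _; rewrite mulrAC stE hb [leRHS]mulrACA.
apply: ler_wpM2l; first exact: mulr_ge0.
have : 0 <= (h / 2) * (1 + h / 2) by rewrite mulr_ge0 // ?addr_ge0 ?divr_ge0.
lra.
Qed.

End Asymptotics.

Local Open Scope classical_set_scope.
Local Open Scope ring_scope.

Theorem theorem8p1 (R : realType) (C : R) (hC : 0 < C) :
  exists lambda0 eps0 K : R,
    [/\ 0 < lambda0, 0 < eps0 < 1, 0 < K &
    \forall n \near \oo, forall (m : nat) (lambda eps p : R),
      `|n%:R - m%:R| <= C * n%:R `^ (2 / 3) ->
      eps = lambda * (m * n)%:R `^ (- (1 / 6)) ->
      p = (1 + eps) / (2 * (m * n)%:R `^ (1 / 2)) ->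
      lambda0 < `|lambda| ->
      `|eps| < eps0 ->
      (lambda < 0 ->
        exists g : R, `|g| <= K * `|lambda| ^- 3 /\
          prob_satisfiable n m p = expR (- g)) /\
      (0 < lambda ->
        exists g : R, `|g| <= K * lambda ^+ 3 /\
          prob_satisfiable n m p = expR (- g))].
Proof.
pose A := supercritical_constant R; have A0 : 0 < A := supercritical_constant_gt0 R.
(* [8 C + 8] is the threshold of [max_div_le], [1/3] ensures [3 e < 1], and 192 and [108 A] are the
   constants of the two regimes. *)
exists (8 * C + 8), (1 / 3), (192 + 108 * A).
split; [lra|by apply/andP; split; lra|by rewrite addr_gt0 // mulr_gt0|].
pose X := (2 * C + 2) ^+ 3.
have X0 : 0 <= X by rewrite exprn_ge0 //; lra.
exists (Num.truncn X).+1 => // n /= nX m l e p dnm eE pE lC e3.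
have Xn : X <= n%:R.
  have /andP[_ /ltW/le_trans] := truncn_itv X0; apply.
  by rewrite ler_nat.
set x : R := n%:R in dnm Xn *; set y : R := m%:R in dnm *.
have x0 : 0 <= x by exact: ler0n.
pose a := x `^ (1 / 3); pose b := (m * n)%:R `^ (1 / 6) : R.
have a3 : x = a ^+ 3 by rewrite powR_expn // mul1r mulVf ?pnatr_eq0 // powRr1.
have aC : 2 * C + 2 <= a.
  have : (2 * C + 2) ^+ 3 <= a ^+ 3 by rewrite -a3.
  by rewrite ler_pXn2r // nnegrE ?powR_ge0 //; lra.
have b6 : x * y = b ^+ 6.
  by rewrite powR_expn // mul1r mulVf ?pnatr_eq0 // powRr1 // natrM mulrC.
have a2 : x `^ (2 / 3) = a ^+ 2.
  by rewrite powR_expn //; congr (_ `^ _); rewrite mulrAC mul1r.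
have b3 : (m * n)%:R `^ (1 / 2) = b ^+ 3.
  by rewrite powR_expn //; congr (_ `^ _); field.
rewrite a2 in dnm.
(* If [m = 0], then [n <= C n^(2/3)], that is [a <= C]. *)
have m0 : (0 < m)%N.
  rewrite lt0n; apply/eqP => m0; move: dnm; rewrite /y m0 subr0 ger0_norm // a3 exprS.
  have : 0 < a ^+ 2 by rewrite exprn_gt0 //; lra.
  by move=> a20; rewrite ler_pM2r //; lra.
have n0 : (0 < n)%N by apply: leq_trans nX.
have b0 : 0 < b by rewrite powR_gt0 // ltr0n muln_gt0 m0.
have b30 : 0 < b ^+ 3 by rewrite exprn_gt0.
have {}eE : e = l / b by rewrite eE powRN.
have {}pE : p = (1 + e) / (2 * b ^+ 3) by rewrite pE b3.
have /andP[M1 M2] := max_div_le hC aC b0 a3 b6 dnm eE lC.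
have NE : (degree n m)%:R = 2 * Num.max x y.
  rewrite /degree natrM /x /y /maxn maxElt ltr_nat.
  by case: ltnP.
have N8 : (8 <= degree n m)%N.
  have : 8 <= x.
    apply: le_trans Xn; have : 2 ^+ 3 <= X by rewrite lerXn2r ?nnegrE //; lra.
    by rewrite -natrX.
  rewrite ler_nat => n8; apply: leq_trans n8 _.
  by rewrite /degree mul2n -addnn (leq_trans (leq_maxl n m)) // leq_addr.
have N8' : 8 <= (degree n m)%:R :> R by rewrite ler_nat.
set M := Num.max x y in M1 M2 NE.
have /andP[e1 e2] : - (1 / 3) < e < 1 / 3 by rewrite -ltr_norml.
have p0 : 0 <= p by rewrite pE divr_ge0 ?mulr_ge0 ?(ltW b30) //; lra.
have NpE : (degree n m)%:R * p * b ^+ 3 = (1 + e) * M.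
  by rewrite NE pE; field; rewrite gt_eqF.
have Np8 : 8 * p <= (degree n m)%:R * p by rewrite ler_wpM2r.
split=> [l0|l0].
  have en : `|e| = - e.
    by rewrite ler0_norm // eE pmulr_lle0 ?invr_gt0 // ltW.
  rewrite en in M2.
  have ell : - e * b = `|l| by rewrite ltr0_norm // eE mulNr divfK // gt_eqF.
  have l30 : 0 < `|l| by lra.
  have ne0 : 0 < - e by rewrite -(pmulr_lgt0 _ b0) ell.
  (* The imbalance costs at most half of the distance to criticality, so [d = - e / 2]. *)
  have Np : (degree n m)%:R * p <= 1 - (- e / 2).
    rewrite -(ler_pM2r b30) NpE.
    apply: le_trans (_ : (1 + e) * (b ^+ 3 * (1 + - e / 2)) <= _).
      by rewrite ler_wpM2l //; lra.
    have : 0 <= b ^+ 3 * (e * e) by rewrite mulr_ge0 ?(ltW b30) // -expr2 sqr_ge0.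
    lra.
  have p01 : 0 <= p <= 1 by rewrite p0; lra.
  have l3 : 24 * p / (- e / 2) ^+ 3 <= 96 * `|l| ^- 3.
    have en0 : e != 0 by rewrite -oppr_eq0 gt_eqF.
    rewrite -ell pE.
    have -> : 24 * ((1 + e) / (2 * b ^+ 3)) / (- e / 2) ^+ 3 =
        96 * (- e * b) ^- 3 * (1 + e).
      by field; rewrite en0 gt_eqF.
    by rewrite ler_piMr ?mulr_ge0 ?invr_ge0 ?exprn_ge0 //; [rewrite mulr_ge0 ?ltW|lra].
  have l8 : 96 * `|l| ^- 3 <= 2^-1.
    rewrite ler_pdivrMr ?exprn_gt0 //.
    have : 8 ^+ 3 <= `|l| ^+ 3 by rewrite lerXn2r ?nnegrE //; lra.
    by rewrite -natrX => h; lra.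
  apply: prob_satisfiable_ge_expR => //.
  apply: le_trans (prob_satisfiable_subcritical p01 _ Np (le_trans l3 l8)); last first.
    by rewrite divr_gt0.
  rewrite ler_expR lerN2; apply: le_trans (_ : 2 * (96 * `|l| ^- 3) <= _).
    by apply: le_trans (_ : 2 * (24 * p / (- e / 2) ^+ 3) <= _); [lra|rewrite ler_wpM2l].
  rewrite mulrA -natrM ler_wpM2r ?invr_ge0 ?exprn_ge0 //.
  by rewrite lerDl mulr_ge0 // ltW.
have ell : e * b = l by rewrite eE divfK // gt_eqF.
have e0 : 0 < e by rewrite -(pmulr_lgt0 _ b0) ell.
rewrite (gtr0_norm e0) in M2; rewrite (gtr0_norm l0) in lC.
(* The supercritical bound is used with [d = 3 e]; then [N d^3] lies between [54 l^3] and [108 l^3],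
   in particular above 48. *)
have Np : 1 <= (degree n m)%:R * p <= 1 + 3 * e.
  apply/andP; split; rewrite -(ler_pM2r b30) NpE.
    rewrite mul1r; apply: (le_trans M1); rewrite ler_peMl //; last by lra.
    by apply: le_trans M1; apply: ltW.
  apply: le_trans (_ : (1 + e) * (b ^+ 3 * (1 + e / 2)) <= _).
    by rewrite ler_wpM2l //; lra.
  have : 0 <= b ^+ 3 * (e * (1 - e)) by rewrite mulr_ge0 ?(ltW b30) // mulr_ge0 //; lra.
  lra.
have p01 : 0 <= p <= 1 by case/andP: Np => _ Np2; rewrite p0; lra.
have Nd : (degree n m)%:R * (3 * e) ^+ 3 = 54 * M * e ^+ 3 by rewrite NE; ring.
have e30 : 0 <= e ^+ 3 by rewrite exprn_ge0 // ltW.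
have lE : l ^+ 3 = b ^+ 3 * e ^+ 3 by rewrite -ell exprMn mulrC.
have Nlo : 54 * l ^+ 3 <= (degree n m)%:R * (3 * e) ^+ 3.
  by rewrite Nd lE mulrA ler_wpM2r // ler_wpM2l.
have Nhi : (degree n m)%:R * (3 * e) ^+ 3 <= 108 * l ^+ 3.
  rewrite Nd lE mulrA ler_wpM2r //; apply: le_trans (_ : 54 * (b ^+ 3 * (1 + e / 2)) <= _).
    by rewrite ler_wpM2l.
  have : b ^+ 3 * (e / 2) <= b ^+ 3 * 1 by rewrite ler_wpM2l ?(ltW b30) //; lra.
  lra.
have l31 : 1 <= l ^+ 3 by rewrite exprn_ege1 //; lra.
apply: prob_satisfiable_ge_expR => //.
apply: le_trans (prob_satisfiable_supercritical p0 _ N8 Np _); last by lra.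
  rewrite ler_expR lerN2; apply: le_trans (ler_wpM2l (ltW A0) Nhi) _.
  have -> : A * (108 * l ^+ 3) = 108 * A * l ^+ 3 by ring.
  by rewrite [leRHS]mulrDl lerDr mulr_ge0 // (le_trans ler01).
by apply/andP; split; lra.
Qed.
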